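(* Let $\lambda>0$ and let $X$ be a stationary Poisson point process in $\mathbb{R}^d$ of intensity $\lambda$; for each positive integer $m$ let $X^+=X^+_m$ be a stationary Poisson point process in $\mathbb{R}^d$ of intensity $\lambda(1+\frac1m)$. Let $S:\mathbf{N}\to\mathbb{R}$ be a measurable function on the space $\mathbf{N}$ of locally finite point sets in $\mathbb{R}^d$, and let $R(X)$ be a radius of influence of $S(X)$, with associated function $f$. If $\mathbb{E}\big(f(R(X))^2 R(X)^{2d}\big)$ exists (is finite), then $$\operatorname{Var} S(X) \leq \lim_{m \to \infty} \mathbb{E} \sum_{x \in X^+} \big(S(X^+ \setminus \{x\}) - S(X^+)\big)^2.$$
   Context: A point process is identified with its support. Radius of influence: for a locally finite set $Y\subset\mathbb{R}^d$, $R(Y)$ is called the radius of influence of $S(Y)$ if there is a function $f:\mathbb{R}\to\mathbb{R}$ (the same for all $Y$) such that for arbitrary locally finite point sets $D\subset\mathbb{R}^d$ and $D^\circ\subset\mathbb{R}^d\setminus R(Y)B^d$ one has $S(Y)=S(Y\cup D^\circ)$ and $|S(Y)-S(Y\cup D)|\le f(R(Y))$. Here $B^d$ is the Euclidean unit ball centered at the origin, and $R(X)$ is the random variable obtained by taking $Y$ to be the realization of $X$.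
   Formalization: The limit on the right need not exist under the stated hypotheses; the variance is bounded by the lower limit (liminf) as m tends to infinity instead, and by the limit itself whenever that limit exists in [0, infinity]. *)

(* Defs.v *)
(* Library: MathComp-Analysis. *)
From HB Require Import structures.
From mathcomp Require Import all_boot all_order all_algebra.
From mathcomp Require Import all_classical all_reals all_analysis.
From mathcomp Require Import measurable_realfun.

Set Implicit Arguments.
Unset Strict Implicit.
Unset Printing Implicit Defensive.

Import Order.TTheory GRing.Theory Num.Theory.
Import numFieldNormedType.Exports.

Local Open Scope classical_set_scope.
Local Open Scope ring_scope.

(* Points of R^n are n-tuples of reals: the library equips [n.-tuple R] with
   the product sigma-algebra, i.e. the Borel sigma-algebra of R^n. *)

(* n-dimensional Lebesgue measure, as an iterated product measure. *)
Fixpoint lebesgue_tuple (R : realType) (n : nat) :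
    set (n.-tuple R) -> \bar R :=
  match n with
  | 0 => \d_([tuple] : 0.-tuple R)
  | m.+1 => pushforward (@lebesgue_measure R \x @lebesgue_tuple R m)%E
              (fun p : R * m.-tuple R => [tuple of p.1 :: p.2])
  end.

Definition euclidean_norm (R : realType) (n : nat) (x : n.-tuple R) : R :=
  Num.sqrt (\sum_(i < n) tnth x i ^+ 2).

(* The dilate r B^n of the closed Euclidean unit ball. *)
Definition dilated_ball (R : realType) (n : nat) (r : R) : set (n.-tuple R) :=
  [set [tuple r * tnth b i | i < n] | b in [set b | euclidean_norm b <= 1]].

Definition locally_finite (R : realType) (n : nat) (Y : set (n.-tuple R)) :=
  forall r : R, finite_set (Y `&` [set x | euclidean_norm x <= r]).

Record locfin (R : realType) (n : nat) : Type := Locfin {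
  support :> set (n.-tuple R) ;
  locfinP : locally_finite support }.

HB.instance Definition _ (R : realType) (n : nat) := gen_eqMixin (locfin R n).
HB.instance Definition _ (R : realType) (n : nat) :=
  gen_choiceMixin (locfin R n).

Lemma locally_finite_set0 (R : realType) (n : nat) :
  locally_finite (set0 : set (n.-tuple R)).
Proof. by move=> r; rewrite set0I. Qed.

HB.instance Definition _ (R : realType) (n : nat) :=
  isPointed.Build (locfin R n) (Locfin (@locally_finite_set0 R n)).

(* The sigma-algebra on the space of locally finite sets is the smallest one
   for which every counting map Y |-> #(Y `&` B), B Borel, is measurable. *)
Definition count_events (R : realType) (n : nat) : set (set (locfin R n)) :=
  [set A | exists (B : set (n.-tuple R)) (V : set (\bar R)),
    [/\ measurable B, measurable V &
        A = (fun Y : locfin R n => counting (Y `&` B)) @^-1` V]].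

HB.instance Definition _ (R : realType) (n : nat) :=
  @isMeasurable.Build (sigma_display (@count_events R n)) (locfin R n)
    <<s @count_events R n >> (@sigma_algebra0 _ setT _)
    (@sigma_algebraC _ _) (@sigma_algebra_bigcup _ setT _).

Lemma locally_finiteU (R : realType) (n : nat) (Y D : locfin R n) :
  locally_finite (Y `|` D).
Proof. by move=> r; rewrite setIUl finite_setU; split; exact: locfinP. Qed.

Definition locfinU (R : realType) (n : nat) (Y D : locfin R n) : locfin R n :=
  Locfin (locally_finiteU Y D).

Lemma locally_finiteD1 (R : realType) (n : nat) (Y : locfin R n)
  (x : n.-tuple R) : locally_finite (Y `\ x).
Proof.
by move=> r; apply: sub_finite_set (locfinP Y r) => z [[Yz _] rz]; split.
Qed.

Definition locfinD1 (R : realType) (n : nat) (Y : locfin R n)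
  (x : n.-tuple R) : locfin R n := Locfin (locally_finiteD1 Y x).

(* Since V i may be the full space, this yields the product rule for every
   subfamily. *)
Definition independent_family d (T : measurableType d) (R : realType)
    (P : probability T R) (k : nat) (Z : 'I_k -> T -> \bar R) : Prop :=
  forall V : 'I_k -> set (\bar R), (forall i, measurable (V i)) ->
  P (\bigcap_i (Z i @^-1` V i)) = (\prod_(i < k) P (Z i @^-1` V i))%E.

(* The number of points in B is Poisson distributed with parameter
   lambda * vol(B); the second argument of the library's [poisson_prob rate k]
   is a dummy, and [poisson_prob 0 k] is the Dirac measure at 0. *)
Definition stationary_poisson_process d (T : measurableType d) (R : realType)
    (P : probability T R) (n : nat) (lambda : R)
    (X : {RV P >-> locfin R n}) : Prop :=
  (forall B : set (n.-tuple R), measurable B ->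
     (lebesgue_tuple B < +oo)%E ->
     forall k : nat,
       P [set w | counting (X w `&` B) = k%:R%:E :> \bar R] =
       poisson_prob (lambda * fine (lebesgue_tuple B)) 0 [set k]) /\
  (forall (k : nat) (B : 'I_k -> set (n.-tuple R)),
     (forall i, measurable (B i)) -> trivIset setT B ->
     independent_family P (fun i w => counting (X w `&` B i))).

Definition radius_of_influence (R : realType) (n : nat)
    (S Rad : locfin R n -> R) (f : R -> R) : Prop :=
  forall Y D D0 : locfin R n, D0 `<=` ~` dilated_ball (Rad Y) ->
    S Y = S (locfinU Y D0) /\ `|S Y - S (locfinU Y D)| <= f (Rad Y).

(* Main.v *)
(* Write X^+ as the superposition of m+1 independent Poisson processes of
   intensity lambda/m; any m of them together have the law of X.  The jackknife
   form of the Efron-Stein inequality gives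
     Var S(X) <= (m+1) E (S(X u V) - S(X))^2,
   where V is one more piece, independent of X.  Fix a realization Y of X and
   let r = R(Y).  If V misses r B^d, the increment is 0.  If x is the only point
   of V in r B^d, then S(Y u V \ {x}) = S(Y), so the squared increment is one of
   the summands (S(Z \ {x}) - S(Z))^2, x in V, with Z = Y u V.  Two or more
   points occur with probability O((r^d / m)^2) and cost at most f(r)^2, so after
   multiplication by m+1 and integration over Y their contribution is O(1/m).
   By exchangeability of the pieces, (m+1) times the expected sum over x in V is
   the expected sum over x in X^+.

   Laws of point processes are compared through the avoidance probabilities
   P(X n B = empty), which determine them (Renyi); superpositions and dilations
   are immediate at that level. *)

Require Import Defs.
From HB Require Import structures.
From mathcomp Require Import all_boot all_order all_algebra.
From mathcomp Require Import all_classical all_reals all_analysis.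
From mathcomp Require Import measurable_realfun.
From mathcomp Require Import ring lra.

Import Order.TTheory GRing.Theory Num.Theory.
Import numFieldNormedType.Exports.

Local Open Scope classical_set_scope.
Local Open Scope ring_scope.

(** * Integrals of bounded measurable functions *)

(** Taking Y empty in the definition of the radius of influence gives |S(D)| <= |S(empty)| +
    f(R(empty)) for every D, so S is bounded. Hence the variance and jackknife inequalities involve
    only integrals of bounded measurable functions, where Fubini needs no further integrability
    condition; the moment hypothesis controls the two-point error.

    The obstacle is the sum over the points x of V or X^+, whose measurability in the configuration
    is not clear. It is replaced by finite sums over the cells of a partition of space: only points
    alone in their cell count, and the whole cell is deleted instead of the point. These sums are
    measurable and lie below the true sum. Along refining partitions their lower limit dominates the
    squared increment as soon as at most one point of V matters. Exchangeability is used at each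
    fixed level, and Fatou's lemma passes to the limit.

    No process of intensity lambda/m is given; its law is manufactured from X by dilating one
    coordinate. *)

Definition bounded_measurable {R : realType} {d} {T : measurableType d}
    (g : T -> R) :=
  measurable_fun [set: T] g /\ exists C, forall x, `|g x| <= C.

Section bounded_measurable_closure.
Context {R : realType} {d} {T : measurableType d}.
Implicit Types f g : T -> R.

Lemma bm_cst (c : R) : bounded_measurable (fun _ : T => c).
Proof. by split; [exact: measurable_cst|exists `|c|]. Qed.

Lemma bmD {f g} : bounded_measurable f -> bounded_measurable g ->
  bounded_measurable (fun x => f x + g x).
Proof.
move=> [mf [C fC]] [mg [D gD]]; split; first exact: measurable_funD.
by exists (C + D) => x; rewrite (le_trans (ler_normD _ _))// lerD.
Qed.

Lemma bmN {f} : bounded_measurable f -> bounded_measurable (fun x => - f x).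
Proof.
move=> [mf [C fC]]; split; first exact: measurableT_comp.
by exists C => x; rewrite normrN.
Qed.

Lemma bmM {f g} : bounded_measurable f -> bounded_measurable g ->
  bounded_measurable (fun x => f x * g x).
Proof.
move=> [mf [C fC]] [mg [D gD]]; split; first exact: measurable_funM.
by exists (C * D) => x; rewrite normrM ler_pM.
Qed.

Lemma bmX {f} k : bounded_measurable f -> bounded_measurable (fun x => f x ^+ k).
Proof.
move=> bf; elim: k => [|k IH]; first by under eq_fun do rewrite expr0; exact: bm_cst.
by under eq_fun do rewrite exprS; exact: bmM.
Qed.

Lemma bm_sum (I : Type) (s : seq I) (Q : pred I) (F : I -> T -> R) :
  (forall i, bounded_measurable (F i)) ->
  bounded_measurable (fun x => \sum_(i <- s | Q i) F i x).
Proof.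
move=> bF; elim: s => [|i s IH].
  by under eq_fun do rewrite big_nil; exact: bm_cst.
under eq_fun do rewrite big_cons; case: (Q i) => //; exact: bmD.
Qed.

Lemma bm_indic {A : set T} : measurable A -> bounded_measurable (\1_A : T -> R).
Proof.
move=> mA; split; first exact: measurable_indic.
by exists 1 => x; rewrite ger0_norm// indicE; case: (_ \in _).
Qed.

Lemma bm_comp {d'} {T' : measurableType d'} {g} {h : T' -> T} :
  bounded_measurable g -> measurable_fun setT h ->
  bounded_measurable (fun x => g (h x)).
Proof.
move=> [mg [C gC]] mh; split; first exact: measurableT_comp.
by exists C.
Qed.

End bounded_measurable_closure.

Section bounded_measurable_integral.
Context {R : realType} {d} {T : measurableType d}.
Variable p : probability T R.
Implicit Types f g : T -> R.

Lemma bm_integrable {g} : bounded_measurable g ->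
  p.-integrable setT (EFin \o g).
Proof.
move=> [mg [C gC]]; apply: measurable_bounded_integrable => //.
  by rewrite [X in (X < _)%E]probability_setT ltry.
exists C; split; first exact: num_real.
by move=> M CM x _; exact: le_trans (gC x) (ltW CM).
Qed.

Lemma EFin_Rintegral {g} : bounded_measurable g ->
  (\int[p]_x g x)%:E = (\int[p]_x (g x)%:E)%E.
Proof.
by move=> bg; rewrite fineK//; exact: integrable_fin_num (bm_integrable bg).
Qed.

Lemma bm_RintD {f g} : bounded_measurable f -> bounded_measurable g ->
  \int[p]_x (f x + g x) = \int[p]_x f x + \int[p]_x g x.
Proof. by move=> bf bg; rewrite RintegralD//; exact: bm_integrable. Qed.

Lemma bm_RintZ c {f} : bounded_measurable f ->
  \int[p]_x (c * f x) = c * \int[p]_x f x.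
Proof. by move=> bf; rewrite RintegralZl//; exact: bm_integrable. Qed.

Lemma bm_RintB {f g} : bounded_measurable f -> bounded_measurable g ->
  \int[p]_x (f x - g x) = \int[p]_x f x - \int[p]_x g x.
Proof. by move=> bf bg; rewrite RintegralB//; exact: bm_integrable. Qed.

Lemma bm_Rint_sum (I : Type) (s : seq I) (F : I -> T -> R) :
  (forall i, bounded_measurable (F i)) ->
  \int[p]_x (\sum_(i <- s) F i x) = \sum_(i <- s) \int[p]_x F i x.
Proof.
move=> bF; elim: s => [|i s IH].
  under eq_Rintegral do rewrite big_nil.
  by rewrite big_nil Rintegral_cst// mul0r.
under eq_Rintegral do rewrite big_cons.
by rewrite big_cons (bm_RintD (bF i) (bm_sum I s xpredT F bF)) IH.
Qed.

Lemma Rint_cst (c : R) : \int[p]_x c = c.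
Proof.
by rewrite Rintegral_cst//= [X in fine X](_ : _ = 1%E) ?mulr1//;
  exact: probability_setT.
Qed.

Lemma bm_le_Rint {f g} : bounded_measurable f -> bounded_measurable g ->
  (forall x, f x <= g x) -> \int[p]_x f x <= \int[p]_x g x.
Proof. by move=> bf bg fg; apply: le_Rintegral => //; exact: bm_integrable. Qed.

Lemma Rint_ge0 {f} : (forall x, 0 <= f x) -> 0 <= \int[p]_x f x.
Proof. by move=> f0; exact: Rintegral_ge0. Qed.

Lemma Rint_norm_le {f C} : bounded_measurable f -> (forall x, `|f x| <= C) ->
  `|\int[p]_x f x| <= C.
Proof.
move=> bf fC; rewrite (le_trans (le_normr_Rintegral _ _))//.
  exact: bm_integrable.
rewrite -[leRHS](Rint_cst C); apply: bm_le_Rint => //; last exact: bm_cst.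
have [mf [D fD]] := bf; split; first exact: measurableT_comp.
by exists D => x; rewrite normr_id.
Qed.

Definition var f := \int[p]_x (f x - \int[p]_y f y) ^+ 2.

Lemma varE {f} : bounded_measurable f ->
  var f = \int[p]_x f x ^+ 2 - (\int[p]_x f x) ^+ 2.
Proof.
move=> bf; rewrite /var; set c := \int[p]_y f y.
rewrite (_ : (fun x => (f x - c) ^+ 2) =
   (fun x => f x ^+ 2 + (- (2 * c) * f x + c ^+ 2))); last first.
  by apply/funext => x; ring.
have b2 := bmX 2 bf; have bc := bm_cst (T := T) (c ^+ 2).
have bl : bounded_measurable (fun x => - (2 * c) * f x).
  by apply: bmM => //; exact: bm_cst.
rewrite (bm_RintD b2 (bmD bl bc)) (bm_RintD bl bc) (bm_RintZ _ bf) Rint_cst.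
by rewrite -/c; ring.
Qed.

Lemma sqr_Rint_le {f} : bounded_measurable f ->
  (\int[p]_x f x) ^+ 2 <= \int[p]_x f x ^+ 2.
Proof.
by move=> bf; rewrite -subr_ge0 -varE// Rint_ge0// => x; rewrite sqr_ge0.
Qed.

End bounded_measurable_integral.

Section bounded_measurable_fubini.
Context {R : realType} {d1 d2} {T1 : measurableType d1} {T2 : measurableType d2}.
Variable h : T1 -> T2 -> R.
Hypothesis bh : bounded_measurable (fun z : T1 * T2 => h z.1 z.2).

Lemma bm_pair2 x : bounded_measurable (h x).
Proof.
have [mh [C hC]] := bh; split; last by exists C => y; exact: (hC (x, y)).
exact: (measurableT_comp mh (measurable_pair1 x)).
Qed.

Lemma bm_pair1 y : bounded_measurable (h ^~ y).
Proof.
have [mh [C hC]] := bh; split; last by exists C => x; exact: (hC (x, y)).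
exact: (measurableT_comp mh (measurable_pair2 y)).
Qed.

Lemma bm_int (q : probability T2 R) : bounded_measurable (fun x => \int[q]_y h x y).
Proof.
have [mh [C hC]] := bh; split; last first.
  exists C => x; apply: Rint_norm_le; first exact: bm_pair2.
  by move=> y; exact: (hC (x, y)).
(* Measurability of the partial integral comes from integrability on a product, so some law on [T1]
   has to be supplied; any would do. *)
pose m1 : probability T1 R := \d_point.
have ih := bm_integrable (m1 \x q)%E bh.
by apply: measurableT_comp => //; exact: measurable_fubini_F ih.
Qed.

Lemma bm_swap (p : probability T1 R) (q : probability T2 R) :
  \int[p]_x \int[q]_y h x y = \int[q]_y \int[p]_x h x y.
Proof.
have ih := bm_integrable (p \x q)%E bh.
congr fine; under eq_integral do rewrite (EFin_Rintegral q (bm_pair2 _)).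
by rewrite (Fubini ih); apply: eq_integral => y _; rewrite (EFin_Rintegral p (bm_pair1 y)).
Qed.

End bounded_measurable_fubini.

(** * Variance inequalities for convolution semigroups *)

Section convolution_semigroup.
Context {R : realType} {d} {M : measurableType d}.
Variables (op : M -> M -> M) (e : M) (p : nat -> probability M R).
Hypothesis opA : associative op.
Hypothesis opC : commutative op.
Hypothesis op0 : left_id e op.
Hypothesis mop : measurable_fun [set: M * M] (fun z => op z.1 z.2).
Hypothesis p0 : forall g : M -> R, bounded_measurable g -> \int[p 0]_x g x = g e.
Hypothesis pS : forall j (g : M -> R), bounded_measurable g ->
  \int[p j.+1]_x g x = \int[p j]_u \int[p 1]_v g (op u v).

Lemma measurable_op {d'} {T : measurableType d'} {f g : T -> M} :
  measurable_fun setT f -> measurable_fun setT g ->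
  measurable_fun setT (fun x => op (f x) (g x)).
Proof.
move=> mf mg; have mfg : measurable_fun setT (fun x => (f x, g x)).
  exact: measurable_fun_pair.
exact: (measurableT_comp mop mfg).
Qed.

Lemma measurable_fst_comp {d1 d2 d3} {T : measurableType d1}
    {T1 : measurableType d2} {T2 : measurableType d3} {f : T -> T1 * T2} :
  measurable_fun setT f -> measurable_fun setT (fun x => (f x).1).
Proof. by move=> mf; exact: measurableT_comp. Qed.

Lemma measurable_snd_comp {d1 d2 d3} {T : measurableType d1}
    {T1 : measurableType d2} {T2 : measurableType d3} {f : T -> T1 * T2} :
  measurable_fun setT f -> measurable_fun setT (fun x => (f x).2).
Proof. by move=> mf; exact: measurableT_comp. Qed.

Lemma bm_comp2 {d1 d2 d'} {T1 : measurableType d1} {T2 : measurableType d2}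
    {T' : measurableType d'}
    {g : T1 -> T2 -> R} {h1 : T' -> T1} {h2 : T' -> T2} :
  bounded_measurable (fun z : T1 * T2 => g z.1 z.2) ->
  measurable_fun setT h1 -> measurable_fun setT h2 ->
  bounded_measurable (fun x => g (h1 x) (h2 x)).
Proof.
move=> bg m1 m2; have m12 : measurable_fun setT (fun x => (h1 x, h2 x)).
  exact: measurable_fun_pair.
exact: (bm_comp bg m12).
Qed.

Ltac mfun := solve [repeat
  match goal with
  | H : ?A |- ?A => exact H
  | |- measurable_fun _ ?f =>
    match f with
    | (fun x => x) => exact: measurable_id
    | (fun _ => ?c) => exact: measurable_cst
    | (fun x => op _ _) => apply: measurable_op
    | @fst _ _ => exact: measurable_fst
    | @snd _ _ => exact: measurable_snd
    | (fun x => fst _) => apply: measurable_fst_comp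
    | (fun x => snd _) => apply: measurable_snd_comp
    end
  end].

Ltac bm := solve [rewrite ?/var; repeat first
  [ progress cbv beta | match goal with
    | H : ?A |- ?A => exact H
    | |- bounded_measurable (fun _ => ?c) => exact: (bm_cst c)
    | |- bounded_measurable (fun x => - _) => apply: bmN
    | |- bounded_measurable (fun x => _ ^+ _) => apply: bmX
    | |- bounded_measurable (fun x => _ + _) => apply: bmD
    | |- bounded_measurable (fun x => _ * _) => apply: bmM
    | |- bounded_measurable (fun x => Rintegral _ _ _) => apply: bm_int
    end
  | match goal with
    | H : bounded_measurable ?g |- bounded_measurable (fun x => ?g (@?h x)) =>
        apply: (bm_comp (h := h) H); mfun
    | H : bounded_measurable (fun z => ?k z.1 z.2) |-
        bounded_measurable (fun x => ?k (@?h1 x) (@?h2 x)) =>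
        apply: (bm_comp2 (h1 := h1) (h2 := h2) H); mfun
    | H : bounded_measurable (fun z => ?k z.1 z.2) |-
        bounded_measurable (?k ?a) => exact: (bm_pair2 k H a)
    end]].

Lemma eq_Rint {d'} {T : measurableType d'} {q : probability T R} {f g : T -> R} :
  (forall x, f x = g x) -> \int[q]_x f x = \int[q]_x g x.
Proof. by move=> fg; apply: eq_Rintegral => x _. Qed.

(** [p j] plays the law of a superposition of j independent pieces under the union [op]. Total
    variance splits off the last piece; the variance of the conditional mean is at most the mean
    over that piece of the conditional variance, to which the induction hypothesis applies. Since
    [op] is commutative all pieces contribute equally, whence the factor j+1 in place of a sum. *)
Lemma efron_stein j (g : M -> R) : bounded_measurable g ->
  var (p j.+1) g <= j.+1%:R * \int[p j]_u var (p 1) (fun v => g (op u v)).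
Proof.
elim: j g => [|j IH] g bg.
  rewrite mul1r p0; last by bm.
  by under [in leRHS]eq_fun do rewrite op0.
(* Centred in u for each fixed v: integrating [k] in v gives the centred conditional mean, while
   integrating its square in u gives the variance of g with v frozen. *)
pose k u v := g (op u v) - \int[p j.+1]_u' g (op u' v).
have bk : bounded_measurable (fun z => k z.1 z.2) by rewrite /k; bm.
have sumvar : var (p j.+2) g = \int[p j.+1]_u var (p 1) (fun v => g (op u v)) +
    \int[p j.+1]_u (\int[p 1]_v k u v) ^+ 2.
  pose b u := \int[p 1]_v g (op u v).
  have bb : bounded_measurable b by rewrite /b; bm.
  have E1 u : var (p 1) (fun v => g (op u v)) =
      \int[p 1]_v g (op u v) ^+ 2 + - b u ^+ 2 by rewrite varE//; bm.
  have E2 u : \int[p 1]_v k u v = b u - \int[p j.+1]_u' b u'.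
    rewrite (bm_swap (fun u' v => g (op u' v))); last by bm.
    by rewrite /k bm_RintB//; bm.
  have b1 : bounded_measurable (fun u => \int[p 1]_v g (op u v) ^+ 2) by bm.
  have b2 : bounded_measurable (fun x => g x ^+ 2) by bm.
  rewrite (eq_Rint E1) (eq_Rint (fun u => congr1 (fun x => x ^+ 2) (E2 u))).
  rewrite -/(var (p j.+1) b) varE// varE// (bm_RintB _ b1 (bmX 2 bb)).
  by rewrite addrA subrK (pS _ _ b2) (pS _ _ bg).
rewrite sumvar.
have jensen : \int[p j.+1]_u (\int[p 1]_v k u v) ^+ 2 <=
    \int[p 1]_v var (p j.+1) (fun u => g (op u v)).
  rewrite /var -(bm_swap (fun u v => k u v ^+ 2)); last by bm.
  apply: bm_le_Rint; [by bm|by bm|] => u; apply: (sqr_Rint_le (p 1) (f := fun v => k u v)); bm.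
have step : \int[p 1]_v var (p j.+1) (fun u => g (op u v)) <=
    j.+1%:R * \int[p j.+1]_u var (p 1) (fun v => g (op u v)).
  have [W [WE bW]] : exists W, (fun u => var (p 1) (fun v => g (op u v))) = W /\
      bounded_measurable W by eexists; split; [reflexivity|bm].
  have bWU : bounded_measurable (fun z : M * M => W (op z.1 z.2)) by bm.
  rewrite WE (pS _ _ bW) (bm_swap (fun u v => W (op u v)) bWU).
  have b3 : bounded_measurable (fun v => \int[p j]_u W (op u v)) by bm.
  rewrite -(bm_RintZ _ _ b3).
  apply: bm_le_Rint; [by bm|by bm|] => v.
  have bgv : bounded_measurable (fun u => g (op u v)) by bm.
  apply: le_trans (IH _ bgv) _; rewrite le_eqVlt; apply/orP; left; apply/eqP.
  congr (_ * _); apply: eq_Rint => u; rewrite -WE; congr (var _ _).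
  by apply/funext => v'; rewrite -!opA [op v' v]opC.
rewrite -[j.+2%:R]natr1 mulrDl mul1r.
by lra.
Qed.

(** The difference of the two integrands is g f(v') - g f(v) + f(v)^2 - f(v) f(v'); the terms in g
    cancel by symmetry and the rest integrates to the variance. With f one piece short of g, it
    expresses a variance through the increments g - f that the jackknife uses. *)
Lemma var_symmetric_split (f : M -> R) (g : M -> M -> R) :
  bounded_measurable f -> bounded_measurable (fun z => g z.1 z.2) ->
  (forall v v', g v v' = g v' v) ->
  var (p 1) f = \int[p 1]_v \int[p 1]_v' (g v v' - f v) ^+ 2 -
    \int[p 1]_v \int[p 1]_v' ((g v v' - f v') * (g v v' - f v)).
Proof.
move=> bf bg gC.
have b1 : bounded_measurable (fun v => \int[p 1]_v' (g v v' - f v) ^+ 2) by bm.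
have b2 : bounded_measurable
  (fun v => \int[p 1]_v' ((g v v' - f v') * (g v v' - f v))) by bm.
rewrite -(bm_RintB _ b1 b2).
have b3 : bounded_measurable (fun v => \int[p 1]_v' (g v v' * f v')) by bm.
have b4 : bounded_measurable (fun v => \int[p 1]_v' (g v v' * f v)) by bm.
have b5 : bounded_measurable (fun v => f v ^+ 2 - f v * \int[p 1]_v' f v') by bm.
have -> : \int[p 1]_v (\int[p 1]_v' (g v v' - f v) ^+ 2 -
    \int[p 1]_v' ((g v v' - f v') * (g v v' - f v))) =
    \int[p 1]_v ((\int[p 1]_v' (g v v' * f v') - \int[p 1]_v' (g v v' * f v))
      + (f v ^+ 2 - f v * \int[p 1]_v' f v')).
  apply: eq_Rint => v.
  have bg1 : bounded_measurable (fun v' => g v v') by bm.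
  have c1 : bounded_measurable (fun v' => (g v v' - f v) ^+ 2) by bm.
  have c2 : bounded_measurable (fun v' => (g v v' - f v') * (g v v' - f v)) by bm.
  have c3 : bounded_measurable (fun v' => g v v' * f v') by bm.
  have c4 : bounded_measurable (fun v' => g v v' * f v) by bm.
  have c5 : bounded_measurable (fun v' => - f v * f v') by bm.
  have c6 : bounded_measurable (fun v' : M => f v ^+ 2) by bm.
  rewrite -(bm_RintB _ c1 c2) -(bm_RintB _ c3 c4) -mulNr -(bm_RintZ _ _ bf).
  rewrite -{1}(Rint_cst (p 1) (f v ^+ 2)) -(bm_RintD _ c6 c5).
  rewrite -(bm_RintD _ (bmD c3 (bmN c4)) (bmD c6 c5)).
  by apply: eq_Rint => v'; ring.
rewrite (bm_RintD _ (bmD b3 (bmN b4)) b5) (bm_RintB _ b3 b4).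
have -> : \int[p 1]_v \int[p 1]_v' (g v v' * f v') =
    \int[p 1]_v \int[p 1]_v' (g v v' * f v).
  rewrite bm_swap; last by bm.
  by apply: eq_Rint => v; apply: eq_Rint => v'; rewrite gC.
have b6 : bounded_measurable (fun v => f v * \int[p 1]_v' f v') by bm.
rewrite (bm_RintB _ (bmX 2 bf) b6) RintegralZr//; last exact: bm_integrable.
by rewrite subrr add0r -expr2 varE.
Qed.

(* The bound is the nonnegativity of E[(sum_k phi_k + chi(Z))^2], where Z is
   the superposition of i+1 independent copies and phi_k = phi(Z without its
   k-th part, k-th part). *)
Lemma symmetric_sum_sqr_ge0 i (phi : M -> M -> R) (chi : M -> R) :
  bounded_measurable (fun z => phi z.1 z.2) -> bounded_measurable chi ->
  0 <= i.+1%:R * \int[p i]_w \int[p 1]_v phi w v ^+ 2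
     + (i.+1 * i)%:R * \int[p i.-1]_u \int[p 1]_v \int[p 1]_v'
         (phi (op u v') v * phi (op u v) v')
     + (i.+1 * 2)%:R * \int[p i]_w \int[p 1]_v (phi w v * chi (op w v))
     + \int[p i.+1]_z chi z ^+ 2.
Proof.
elim: i phi chi => [|i IH] phi chi bphi bchi.
  have b0 : bounded_measurable (fun w => \int[p 1]_v phi w v ^+ 2) by bm.
  have b1 : bounded_measurable (fun w => \int[p 1]_v (phi w v * chi (op w v)))
    by bm.
  have b2 : bounded_measurable (fun v => phi e v) by bm.
  have b3 : bounded_measurable (fun v => phi e v * chi v) by bm.
  rewrite muln0 mul0r addr0 (p0 _ b0) (p0 _ b1) mul1r mul1n.
  under [\int[p 1]_v (phi e v * chi (op e v))]eq_Rint do rewrite op0.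
  rewrite -(bm_RintZ _ _ b3) -(bm_RintD _ (bmX 2 b2) (bmM (bm_cst _) b3)).
  rewrite -(bm_RintD _ (bmD (bmX 2 b2) (bmM (bm_cst _) b3)) (bmX 2 bchi)).
  apply: Rint_ge0 => v.
  rewrite (_ : _ + _ = (phi e v + chi v) ^+ 2) ?sqr_ge0//; ring.
set a' := \int[p i.+1]_w \int[p 1]_v phi w v ^+ 2.
set b' := \int[p i.+1.-1]_u _.
set d' := \int[p i.+1]_w \int[p 1]_v (phi w v * chi (op w v)).
set e' := \int[p i.+2]_z _.
(* Freeze the last part t. The term that omits t joins chi, the other phi_k see t as a constant, and
   [K1] to [K4] are the four integrals of the induction hypothesis for these data. The enlarged chi
   then supplies the missing multiples: [K3] one more cross term b', [K4] one more a' and 2 d'. *)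
pose K1 t := \int[p i]_w \int[p 1]_v phi (op w t) v ^+ 2.
pose K2 t := \int[p i.-1]_u \int[p 1]_v \int[p 1]_v'
         (phi (op (op u v') t) v * phi (op (op u v) t) v').
pose K3 t := \int[p i]_w \int[p 1]_v
         (phi (op w t) v * (chi (op (op w v) t) + phi (op w v) t)).
pose K4 t := \int[p i.+1]_z (chi (op z t) + phi z t) ^+ 2.
have bK1 : bounded_measurable K1 by rewrite /K1; bm.
have bK2 : bounded_measurable K2 by rewrite /K2; bm.
have bK3 : bounded_measurable K3 by rewrite /K3; bm.
have bK4 : bounded_measurable K4 by rewrite /K4; bm.
have K_ge0 : 0 <= i.+1%:R * \int[p 1]_t K1 t + (i.+1 * i)%:R * \int[p 1]_t K2 t +
    (i.+1 * 2)%:R * \int[p 1]_t K3 t + \int[p 1]_t K4 t.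
  have c1 := bmM (bm_cst i.+1%:R) bK1.
  have c2 := bmM (bm_cst (i.+1 * i)%:R) bK2.
  have c3 := bmM (bm_cst (i.+1 * 2)%:R) bK3.
  rewrite -(bm_RintZ _ _ bK1) -(bm_RintZ _ _ bK2) -(bm_RintZ _ _ bK3).
  rewrite -(bm_RintD _ c1 c2) -(bm_RintD _ (bmD c1 c2) c3).
  rewrite -(bm_RintD _ (bmD (bmD c1 c2) c3) bK4).
  apply: Rint_ge0 => t.
  apply: (IH (fun w v => phi (op w t) v) (fun z => chi (op z t) + phi z t)); bm.
have K1E : \int[p 1]_t K1 t = a'.
  have b1 : bounded_measurable (fun w => \int[p 1]_v phi w v ^+ 2) by bm.
  rewrite /a' (pS _ _ b1).
  by rewrite (bm_swap (fun w t => \int[p 1]_v phi (op w t) v ^+ 2)); last bm.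
have K2E : (i.+1 * i)%:R * \int[p 1]_t K2 t = (i.+1 * i)%:R * b'.
  (* For i = 0 the truncated index [i.-1] is meaningless, but its coefficient vanishes. *)
  have [->|i_gt0] := posnP i; first by rewrite muln0 !mul0r.
  have pi : p i = p i.-1.+1 by rewrite prednK.
  congr (_ * _); rewrite /K2 /b' /= [p i]pi.
  have b1 : bounded_measurable (fun u => \int[p 1]_v \int[p 1]_v'
      (phi (op u v') v * phi (op u v) v')) by bm.
  rewrite (pS _ _ b1) bm_swap; last by bm.
  apply: eq_Rint => u; apply: eq_Rint => t; apply: eq_Rint => v.
  by apply: eq_Rint => v'; rewrite -!opA [op t v']opC [op t v]opC.
have K3E : \int[p 1]_t K3 t = d' + b'.
  have b1 : bounded_measurable
    (fun w => \int[p 1]_v (phi w v * chi (op w v))) by bm.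
  have b2 : bounded_measurable (fun u => \int[p 1]_t \int[p 1]_v
    (phi (op u t) v * chi (op (op u t) v))) by bm.
  have b3 : bounded_measurable (fun u => \int[p 1]_v \int[p 1]_v'
      (phi (op u v') v * phi (op u v) v')) by bm.
  rewrite /d' /b' (pS _ _ b1) -(bm_RintD _ b2 b3) bm_swap; last by bm.
  apply: eq_Rint => u.
  rewrite [X in _ = _ + X]bm_swap; last by bm.
  have b4 : bounded_measurable (fun t => \int[p 1]_v
    (phi (op u t) v * chi (op (op u t) v))) by bm.
  have b5 : bounded_measurable (fun t => \int[p 1]_v
    (phi (op u t) v * phi (op u v) t)) by bm.
  rewrite -(bm_RintD _ b4 b5); apply: eq_Rint => t.
  have b6 : bounded_measurable (fun v => phi (op u t) v * chi (op (op u t) v))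
    by bm.
  have b7 : bounded_measurable (fun v => phi (op u t) v * phi (op u v) t) by bm.
  rewrite -(bm_RintD _ b6 b7); apply: eq_Rint => v.
  by rewrite mulrDr -!opA [op v t]opC.
have K4E : \int[p 1]_t K4 t = e' + 2 * d' + a'.
  have b0 : bounded_measurable (fun z => chi z ^+ 2) by bm.
  have b1 : bounded_measurable (fun w => \int[p 1]_v chi (op w v) ^+ 2) by bm.
  have b2 : bounded_measurable
    (fun w => \int[p 1]_v (phi w v * chi (op w v))) by bm.
  have b3 : bounded_measurable (fun w => \int[p 1]_v phi w v ^+ 2) by bm.
  have b4 := bmM (bm_cst 2) b2.
  rewrite /e' /d' /a' (pS _ _ b0) -(bm_RintZ _ _ b2) -(bm_RintD _ b1 b4).
  rewrite -(bm_RintD _ (bmD b1 b4) b3).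
  rewrite bm_swap; last by bm.
  apply: eq_Rint => w.
  have c1 : bounded_measurable (fun v => chi (op w v) ^+ 2) by bm.
  have c2 : bounded_measurable (fun v => phi w v * chi (op w v)) by bm.
  have c3 : bounded_measurable (fun v => phi w v ^+ 2) by bm.
  have c4 := bmM (bm_cst 2) c2.
  rewrite -(bm_RintZ _ _ c2) -(bm_RintD _ c1 c4) -(bm_RintD _ (bmD c1 c4) c3).
  by apply: eq_Rint => t; ring.
apply: le_trans K_ge0 _; rewrite le_eqVlt; apply/orP; left; apply/eqP.
rewrite K2E K1E K3E K4E !natrM -[i.+2%:R]natr1 -[i.+1%:R]natr1; ring.
Qed.

(** Write a for the mean square of an increment and b for the mean product of the increments of two
    different pieces. The inner variance averages to a - b by [var_symmetric_split], so the claim is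
    a + (i+1) b >= 0, which is [symmetric_sum_sqr_ge0] with chi = 0 divided by i+2. *)
Lemma jackknife i (g : M -> R) : bounded_measurable g ->
  i.+1%:R * \int[p i]_u var (p 1) (fun v => g (op u v)) <=
  i.+2%:R * \int[p i.+1]_w \int[p 1]_v (g (op w v) - g w) ^+ 2.
Proof.
move=> bg; pose phi w v := g (op w v) - g w.
have bphi : bounded_measurable (fun z => phi z.1 z.2) by rewrite /phi; bm.
have := symmetric_sum_sqr_ge0 i.+1 phi (fun=> 0) bphi (bm_cst 0).
under [X in _ + X]eq_Rint do rewrite expr0n.
rewrite Rint_cst addr0.
rewrite [X in _ + X](_ : _ = 0) ?addr0; last first.
  rewrite (_ : (fun w => _) = (fun=> 0)) ?Rint_cst ?mulr0//.
  by apply/funext => w; under eq_Rint do rewrite mulr0; rewrite Rint_cst.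
set a := (X in _ * X + _ * _); set b := (X in _ + _ * X) => ab0.
have -> : \int[p i]_u var (p 1) (fun v => g (op u v)) = a - b.
  have ba : bounded_measurable (fun w => \int[p 1]_v phi w v ^+ 2) by bm.
  rewrite /a (pS _ _ ba) /b /= -bm_RintB; [|by bm|by bm].
  apply: eq_Rint => u.
  rewrite (var_symmetric_split (fun v => g (op u v))
     (fun v v' => g (op (op u v) v'))); [|by bm|by bm|].
    congr (_ - _); apply: eq_Rint => v; apply: eq_Rint => v'.
    by rewrite /phi -!opA [op v' v]opC mulrC.
  by move=> v v'; rewrite -!opA [op v' v]opC.
rewrite -/a; move: ab0; rewrite natrM -mulrA -mulrDr pmulr_rge0 ?ltr0n//.
rewrite -[i.+2%:R]natr1 => ab0; rewrite mulrBr mulrDl mul1r.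
by lra.
Qed.

(* i0 and i1 stand for the indicators of "no point in c" and "exactly one point
   in c": each of the j+1 pieces is equally likely to contain the point. *)
Lemma marked_part j (i0 i1 h : M -> R) :
  bounded_measurable i0 -> bounded_measurable i1 -> bounded_measurable h ->
  (forall u, 0 <= i0 u <= 1) -> (forall u, 0 <= i1 u) -> (forall u, 0 <= h u) ->
  (forall u v, i0 (op u v) = i0 u * i0 v) ->
  (forall u v, i1 u * i0 v + i0 u * i1 v <= i1 (op u v)) ->
  j.+1%:R * \int[p j]_u \int[p 1]_v (i0 u * i1 v * h (op u v)) <=
  \int[p j.+1]_z (i1 z * h z).
Proof.
move=> b0 b1; move=> + i01 i1_ge0 + i0M i1D.
elim: j h => [|j IH] h bh h0.
  rewrite mul1r p0; last by bm.
  apply: bm_le_Rint; [by bm|by bm|] => v.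
  rewrite op0 ler_wpM2r// ler_piMl//.
  by have /andP[] := i01 e.
pose k u v := i1 u * i0 v * h (op u v) + i0 u * i1 v * h (op u v).
have bl : bounded_measurable (fun z => k z.1 z.2) by rewrite /k; bm.
have b2 : bounded_measurable (fun z => i1 z * h z) by bm.
apply: (@le_trans _ _ (\int[p j.+1]_u \int[p 1]_v k u v)); last first.
  rewrite (pS _ _ b2); apply: bm_le_Rint; [by bm|by bm|] => u.
  apply: bm_le_Rint; [by bm|by bm|] => v.
  by rewrite /k -mulrDl ler_wpM2r.
have c1 : bounded_measurable
  (fun u => \int[p 1]_v (i1 u * i0 v * h (op u v))) by bm.
have c2 : bounded_measurable
  (fun u => \int[p 1]_v (i0 u * i1 v * h (op u v))) by bm.
have -> : \int[p j.+1]_u \int[p 1]_v k u v =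
    \int[p j.+1]_u \int[p 1]_v (i1 u * i0 v * h (op u v)) +
    \int[p j.+1]_u \int[p 1]_v (i0 u * i1 v * h (op u v)).
  rewrite -(bm_RintD _ c1 c2); apply: eq_Rint => u.
  have d1 : bounded_measurable (fun v => i1 u * i0 v * h (op u v)) by bm.
  have d2 : bounded_measurable (fun v => i0 u * i1 v * h (op u v)) by bm.
  by rewrite -(bm_RintD _ d1 d2).
rewrite -[j.+2%:R]natr1 mulrDl mul1r lerD2r.
rewrite (pS _ _ c2) bm_swap; last by bm.
rewrite [leRHS]bm_swap; last by bm.
have c3 : bounded_measurable (fun v => \int[p j]_u \int[p 1]_v'
  (i0 (op u v) * i1 v' * h (op (op u v) v'))) by bm.
rewrite -(bm_RintZ _ _ c3); apply: bm_le_Rint; [by bm|by bm|] => v.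
(* When the last piece v is the one without a point in c, it is absorbed into the weight, and the
   induction hypothesis treats the remaining pieces. *)
have bhv : bounded_measurable (fun u => i0 v * h (op u v)) by bm.
have hv_ge0 u : 0 <= i0 v * h (op u v).
  by rewrite mulr_ge0//; have /andP[] := i01 v.
apply: le_trans (le_trans (IH _ bhv hv_ge0) _).
  rewrite le_eqVlt; apply/orP; left; apply/eqP; congr (_ * _).
  apply: eq_Rint => u; apply: eq_Rint => v'.
  by rewrite i0M -!opA [op v v']opC; ring.
rewrite le_eqVlt; apply/orP; left; apply/eqP; apply: eq_Rint => u; ring.
Qed.

End convolution_semigroup.

(** * Lebesgue measure on tuples *)

Definition tuple_cons (R : realType) (n : nat)
    (p : measurableTypeR R * n.-tuple R) : n.+1.-tuple R :=
  [tuple of (p.1 : R) :: p.2].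

Lemma measurable_tuple_cons (R : realType) (n : nat) :
  measurable_fun setT (@tuple_cons R n).
Proof.
exact: measurable_cons. Qed.

(** A copy of [mu] to which a proof of sigma-finiteness can be attached as a structure. *)
Definition with_sigma_finite {d} {T : measurableType d} {R : realType}
  (mu : {measure set T -> \bar R}) (smu : sigma_finite setT mu) :
  set T -> \bar R := mu.

Section with_sigma_finite.
Context {d} {T : measurableType d} {R : realType}.
Variables (mu : {measure set T -> \bar R}) (smu : sigma_finite setT mu).
HB.instance Definition _ := Measure.copy (with_sigma_finite mu smu) mu.
HB.instance Definition _ :=
  Measure_isSigmaFinite.Build _ _ _ (with_sigma_finite mu smu) smu.
End with_sigma_finite.

(** [lebesgue_tuple] is a bare set function. This bundled version gives access to the laws of
    measures and to the product formula, and it is a sigma type so that it can be destructed to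
    provide data. *)
Lemma lebesgue_tuple_sigma_finite (R : realType) (n : nat) :
  {mu : {sigma_finite_measure set (n.-tuple R) -> \bar R} |
    mu = @lebesgue_tuple R n :> (set (n.-tuple R) -> \bar R)}.
Proof.
elim: n => [|n [mu muE]].
  by exists (\d_([tuple] : 0.-tuple R)).
pose c := @tuple_cons R n.
have mc : measurable_fun setT c by exact: measurable_tuple_cons.
pose cmix := isMeasurableFun.Build _ _ _ _ _ mc.
pose c' : {mfun _ >-> _} := HB.pack c cmix.
pose nu' : {measure set (n.+1.-tuple R) -> \bar R} :=
  pushforward (@lebesgue_measure R \x mu)%E c'.
pose nu := nu' mc.
have nu_sigma_finite : sigma_finite setT nu.
  have /sigma_finiteP[F [FT ndF Fm]] := sigma_finiteT (@lebesgue_measure R).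
  have /sigma_finiteP[G [GT ndG Gm]] := sigma_finiteT mu.
  pose uncons (t : n.+1.-tuple R) :=
    ((thead t : measurableTypeR R), [tuple of behead t]).
  have munc : measurable_fun setT uncons.
    by apply: measurable_fun_pair; [exact: measurable_tnth|exact: measurable_behead].
  exists (fun k => uncons @^-1` (F k `*` G k)).
    apply/seteqP; split=> // t _.
    have : [set: measurableTypeR R] (uncons t).1 by [].
    rewrite FT => -[i _ Fi].
    have : [set: n.-tuple R] (uncons t).2 by [].
    rewrite GT => -[j _ Gj].
    (* Both exhausting sequences increase, so a single index serves both factors. *)
    exists (maxn i j) => //; split.
      by move: Fi; exact/subsetPset/ndF/leq_maxl.
    by move: Gj; exact/subsetPset/ndG/leq_maxr.
  move=> k; have [mF Foo] := Fm k; have [mG Goo] := Gm k; split.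
    by rewrite -[X in measurable X]setTI; apply: munc => //; exact: measurableX.
  rewrite /= /pushforward (_ : _ @^-1` _ = F k `*` G k).
    by rewrite product_measure1E// lte_mul_pinfty// ge0_fin_numE.
  have unconsK z : uncons (tuple_cons R n z) = z.
    case: z => x y; rewrite /uncons /tuple_cons theadE /=; congr pair.
    exact: val_inj.
  by rewrite -comp_preimage (_ : uncons \o c' = id)//; apply/funext.
exists (with_sigma_finite nu nu_sigma_finite); apply/funext => A /=.
by rewrite /with_sigma_finite /= /pushforward muE.
Qed.

Lemma lebesgue_tuple_cons (R : realType) (n : nat)
    (mu : {sigma_finite_measure set (n.-tuple R) -> \bar R}) (A : set (n.+1.-tuple R)) :
  mu = @lebesgue_tuple R n :> (set (n.-tuple R) -> \bar R) ->
  lebesgue_tuple A = (@lebesgue_measure R \x mu)%E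
    (@tuple_cons R n @^-1` A).
Proof. by move=> ->. Qed.

Lemma measurable_box (R : realType) (n : nat) (a b : 'I_n -> R) :
  measurable [set x : n.-tuple R | forall i, a i <= tnth x i <= b i].
Proof.
rewrite (_ : [set _ | _] = \bigcap_(i in [set: 'I_n])
  ((fun x : n.-tuple R => tnth x i) @^-1` `[a i, b i]%classic)).
  apply: fin_bigcap_measurable; first exact: finite_finset.
  move=> i _.
  rewrite -[X in measurable X]setTI; apply: (@measurable_tnth _ _ n i) => //.
apply/seteqP; split=> x /= xab i; first by move=> _; rewrite /= in_itv/= xab.
by have := xab i I; rewrite /= in_itv.
Qed.

Lemma lebesgue_tuple_box (R : realType) (n : nat) (a b : 'I_n -> R) :
  (forall i, a i <= b i) ->
  lebesgue_tuple [set x : n.-tuple R | forall i, a i <= tnth x i <= b i] =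
  (\prod_(i < n) (b i - a i))%:E.
Proof.
elim: n a b => [|n IH] a b ab.
  rewrite big_ord0 /= diracE mem_set//= => i; exact: (False_ind _ (notF (ltn_ord i))).
have [mu muE] := lebesgue_tuple_sigma_finite R n.
rewrite (lebesgue_tuple_cons _ _ mu _ muE).
rewrite (_ : _ @^-1` _ = `[a ord0, b ord0]%classic `*`
  [set x : n.-tuple R | forall i, a (lift ord0 i) <= tnth x i <= b (lift ord0 i)]);
    last first.
  apply/seteqP; split=> [[x y] /= xab|[x y] /= [x0 yab] i].
    split; first by have := xab ord0; rewrite /= in_itv/=.
    by move=> i; have := xab (lift ord0 i); rewrite tnthS.
  case: (unliftP ord0 i) => [j|] ->; first by rewrite tnthS.
  by rewrite /=; move: x0; rewrite in_itv.
rewrite product_measure1E; [|exact: (measurable_itv `[a ord0, b ord0])|exact: measurable_box].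
rewrite muE IH; last by move=> i.
rewrite /= lebesgue_measure_itv/= lte_fin big_ord_recl EFinM.
have := ab ord0; rewrite le_eqVlt => /predU1P[->|->]; last by rewrite EFinB.
by rewrite ltxx subrr.
Qed.

(** By uniqueness of Lebesgue measure: s times its image under x |-> s x gives ]a, b] the length s
    (b/s - a/s) = b - a. *)
Lemma lebesgue_measure_scale (R : realType) (s : R) (A : set R) :
  0 < s -> measurable A ->
  lebesgue_measure ((fun x : R => s * x) @^-1` A) =
  ((s^-1)%:E * lebesgue_measure A)%E.
Proof.
move=> s0 mA; have sV0 : 0 <= s by exact: ltW.
pose scale (x : measurableTypeR R) : measurableTypeR R := s * x.
have mscale' : measurable_fun setT scale.
  by apply: measurable_funM => //; exact: measurable_cst.
pose nu' : {measure set (measurableTypeR R) -> \bar R} :=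
  pushforward (@lebesgue_measure R) scale.
pose nu := nu' mscale'.
pose k : {nonneg R} := NngNum sV0.
have -> : lebesgue_measure A = mscale k nu A.
  apply: lebesgue_measure_unique => //= _ [[a b] _ <-].
  rewrite /mscale /= /pushforward (_ : _ @^-1` _ = `]a / s, b / s]%classic).
    rewrite !lebesgue_measure_itv/= !lte_fin ltr_pM2r ?invr_gt0//.
    case: ifP => ab; last by rewrite mule0.
    by rewrite -!EFinB -EFinM -mulrBl mulrCA divff ?gt_eqF// mulr1.
  by apply/seteqP; split=> x /=; rewrite !in_itv/= ltr_pdivrMr// ler_pdivlMr// mulrC.
rewrite /mscale /= /pushforward muleA -EFinM mulVf ?gt_eqF// mul1e.
by [].
Qed.


(** Dilating a single coordinate makes the volume factor s itself, with no n-th root, and reduces it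
    to the one-dimensional case on the first factor of the product. *)
Definition stretch (R : realType) (n : nat) (s : R) (x : n.-tuple R) : n.-tuple R :=
  [tuple (if i == 0 :> nat then s else 1) * tnth x i | i < n].

Lemma measurable_stretch (R : realType) (n : nat) (s : R) :
  measurable_fun setT (@stretch R n s).
Proof.
apply/measurable_fun_tnthP => i; rewrite (_ : _ \o _ =
  (fun x => (if i == 0 :> nat then s else 1) * tnth x i)).
  by apply: measurable_funM => //; exact: measurable_tnth.
by apply/funext => x /=; rewrite tnth_mktuple.
Qed.

Lemma lebesgue_tuple_stretch (R : realType) (n : nat) (s : R) (B : set (n.-tuple R)) :
  (0 < n)%N -> 0 < s -> measurable B ->
  lebesgue_tuple (stretch R n s @^-1` B) = ((s^-1)%:E * lebesgue_tuple B)%E.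
Proof.
case: n B => // n B _ s0 mB.
have [mu muE] := lebesgue_tuple_sigma_finite R n.
rewrite !(lebesgue_tuple_cons _ _ mu _ muE).
pose A := tuple_cons R n @^-1` B.
have mA : measurable A.
  by rewrite -[X in measurable X]setTI; exact: measurable_tuple_cons.
pose scale (x : measurableTypeR R) : measurableTypeR R := s * x.
have mscale' : measurable_fun setT scale.
  by apply: measurable_funM => //; exact: measurable_cst.
pose nu' : {measure set (measurableTypeR R) -> \bar R} :=
  pushforward (@lebesgue_measure R) scale.
pose nu := nu' mscale'.
have sV0 : 0 <= s^-1 by rewrite invr_ge0 ltW.
pose k : {nonneg R} := NngNum sV0.
have mF := measurable_fun_xsection mu mA.
rewrite /product_measure1 -/A.
transitivity (\int[nu]_x (mu \o xsection A) x)%E.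
  rewrite ge0_integral_pushforward//.
  rewrite preimage_setT; apply: eq_integral => x _ /=; congr (mu _).
  have stretchE y : stretch R n.+1 s (tuple_cons R n (x, y)) =
      tuple_cons R n (scale x, y).
    apply: eq_from_tnth => i; rewrite tnth_mktuple.
    case: (unliftP ord0 i) => [j|] ->; first by rewrite /= mul1r !tnthS.
    by rewrite /= !tnth0.
  by apply/seteqP; split=> y; rewrite /xsection /= !inE /A /= stretchE.
transitivity (\int[mscale k (@lebesgue_measure R)]_x (mu \o xsection A) x)%E.
  apply: eq_measure_integral => C mC _.
  by rewrite /= /pushforward lebesgue_measure_scale.
by rewrite ge0_integral_mscale// => x _; exact: measure_ge0.
Qed.

(** * Cells and counting *)

Section cells.
Context {R : realType} {n : nat}.
Implicit Types (x y : n.-tuple R) (A B : set (n.-tuple R)) (Y : locfin R n).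

(* An enumeration of the rational half-spaces {x | x_i < q}.  The first k of
   them generate the finite partition of level k; these partitions refine each
   other and separate points. *)
Definition half_space (j : nat) : set (n.-tuple R) :=
  if (unpickle j : option ('I_n * rat)) is Some iq
  then [set x | tnth x iq.1 < ratr iq.2] else set0.

Definition cell_of (k : nat) x : {ffun 'I_k -> bool} :=
  [ffun j : 'I_k => `[< half_space j x >]].

Definition cell k (b : {ffun 'I_k -> bool}) : set (n.-tuple R) :=
  [set x | cell_of k x = b].

Lemma measurable_half_space j : measurable (half_space j).
Proof.
rewrite /half_space; case: unpickle => // -[i q] /=.
rewrite (_ : [set _ | _] = (fun x => tnth x i) @^-1` `]-oo, (ratr q)[%classic).
  rewrite -[X in measurable X]setTI; apply: (@measurable_tnth _ _ n i) => //.
by apply/seteqP; split=> x /=; rewrite in_itv.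
Qed.

Lemma measurable_cell k b : measurable (cell k b).
Proof.
rewrite (_ : cell k b = \bigcap_(j in [set: 'I_k])
    (if b j then half_space j else ~` half_space j)).
  apply: fin_bigcap_measurable; first exact: finite_finset.
  move=> j _; have mH := measurable_half_space j.
  by case: ifP => _ //; exact: measurableC.
apply/seteqP; split=> [x /= <- j _|x xb].
  by rewrite ffunE; case: asboolP.
apply/ffunP => j; rewrite ffunE; have := xb j I.
by case: (b j) => Hx; [exact/asboolP|apply/negbTE/asboolP].
Qed.

Lemma cell_ofP {k j x y} : (j < k)%N -> cell_of k x = cell_of k y ->
  half_space j x <-> half_space j y.
Proof.
move=> jk /ffunP/(_ (Ordinal jk)); rewrite !ffunE /= => xy.
by split=> ?; apply/asboolP; [rewrite -xy|rewrite xy]; exact/asboolP.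
Qed.

Lemma same_half_space {i : 'I_n} {q : rat} {k x y} :
  (pickle (i, q) < k)%N -> cell_of k x = cell_of k y ->
  (tnth x i < ratr q) = (tnth y i < ratr q).
Proof.
move=> jk /(cell_ofP jk); rewrite /half_space pickleK /= => xy.
by apply/idP/idP => /xy.
Qed.

Lemma cells_separate {x y} : x <> y ->
  \forall k \near \oo, cell_of k x <> cell_of k y.
Proof.
move=> xy; have [i xyi] : exists i, tnth x i != tnth y i.
  apply/existsP; apply: contra_notT xy; rewrite negb_exists => /forallP xy.
  by apply: eq_from_tnth => i; apply/eqP; rewrite -[_ == _]negbK.
wlog xyi_lt : x y xy xyi / tnth x i < tnth y i.
  move=> H; have [/H|/H|E] := ltgtP (tnth x i) (tnth y i); first exact.
    rewrite eq_sym => /(_ (nesym xy) xyi).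
    by apply: filterS => k /nesym.
  by rewrite E eqxx in xyi.
have [q] := rat_in_itvoo xyi_lt; rewrite in_itv/= => /andP[xq qy].
exists (pickle (i, q)).+1 => // k /= jk /(same_half_space jk).
by rewrite xq ltNge (ltW qy).
Qed.

Definition box (N : R) : set (n.-tuple R) := [set x | forall i, - N <= tnth x i <= N].

Lemma measurable_cube N : measurable (box N).
Proof. exact: measurable_box. Qed.

Lemma box_natP x : exists N : nat, box N%:R x.
Proof.
exists (Num.truncn (\sum_(i < n) `|tnth x i|)).+1 => i; rewrite -ler_norml.
apply/ltW/(le_lt_trans _ (truncnS_gt _)).
by rewrite (bigD1 i)//= lerDl sumr_ge0.
Qed.

(** A fine enough cell around x is bounded, so local finiteness leaves only finitely many points of
    a configuration to be separated from x. *)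
Lemma cells_bounded x : exists N : nat, \forall k \near \oo,
  forall y, cell_of k y = cell_of k x -> box N%:R y.
Proof.
have [N0 xN0] := box_natP x; exists N0.+1.
(* This level exceeds the index of every half-space x_i < N0+1 and x_i < -(N0+1), so all 2n of them
   have been used; N0+1 makes the bounds on x strict. *)
exists (\sum_(i < n) (pickle (i, N0.+1%:Q) + pickle (i, - N0.+1%:Q))).+1 => //.
move=> k /= jk y yx i.
have {}jk : (pickle (i, N0.+1%:Q) < k)%N && (pickle (i, - N0.+1%:Q) < k)%N.
  rewrite !(leq_trans _ jk)// ltnS (bigD1 i)//= -?addnA ?leq_addr//.
  by rewrite addnCA leq_addr.
have /andP[j1 j2] := jk; have /andP[x1 x2] := xN0 i.
have NN : N0%:R < N0.+1%:R :> R by rewrite ltr_nat.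
have h1 := same_half_space j1 yx; have h2 := same_half_space j2 yx.
rewrite ratr_int in h1; rewrite rmorphN /= ratr_int in h2.
have {}h1 : tnth y i < N0.+1%:R by rewrite h1 (le_lt_trans x2).
have {}h2 : ~~ (tnth y i < - N0.+1%:R).
  by rewrite h2 -leNgt (le_trans _ x1)// lerN2 ltW.
by rewrite leNgt h2 ltW.
Qed.

Lemma locfin_box Y (N : R) : finite_set (Y `&` box N).
Proof.
apply: sub_finite_set (locfinP Y (Num.sqrt (\sum_(i < n) N ^+ 2))).
move=> x [Yx xN]; split=> //=; rewrite /euclidean_norm ler_sqrt; last first.
  by rewrite sumr_ge0// => i _; rewrite sqr_ge0.
apply: ler_sum => i _; rewrite -ler_sqrt ?sqr_ge0// !sqrtr_sqr.
have /andP[x1 x2] := xN i.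
by rewrite (le_trans _ (ler_norm _))// ler_norml x1.
Qed.

(** The level depends on the configuration and on x. This is why lower limits over levels, and not a
    fixed partition, appear later. *)
Lemma cells_isolate Y x : \forall k \near \oo,
  forall y, Defs.support Y y -> cell_of k y = cell_of k x -> y = x.
Proof.
have [N xN] := cells_bounded x.
have /finite_seqP[s Ys] := locfin_box Y N%:R.
have sx : \forall k \near \oo, forall y, y \in s -> cell_of k y = cell_of k x -> y = x.
  elim: s {Ys} => [|z s IH]; first exact: nearW.
  have [->|/eqP zx] := eqVneq z x.
    near=> k => y; rewrite inE => /predU1P[//|ys].
    by move: y ys; near: k.
  near=> k => y; rewrite inE => /predU1P[->|ys].
    by move=> zxk; exfalso; move: zxk; near: k; exact: cells_separate.
  by move: y ys; near: k.
near=> k => y Yy yx.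
have ys : y \in s.
  have : [set` s] y by rewrite -Ys; split=> //; move: y yx {Yy}; near: k.
  by [].
by move: y ys yx {Yy}; near: k.
Unshelve. all: by end_near. Qed.

Definition ncells (k : nat) A : nat :=
  #|[pred b : {ffun 'I_k -> bool} | `[< A `&` cell k b !=set0 >]]|.

Lemma counting_geP A (j : nat) :
  (j%:R%:E <= counting A :> \bar R)%E <->
  exists2 s : seq (n.-tuple R), uniq s /\ size s = j & [set` s] `<=` A.
Proof.
rewrite /counting; case: asboolP => [fA|iA].
  rewrite lee_fin ler_nat; split=> [jA|[s [us <-] sA]].
    exists (take j (finmap.enum_fset (fset_set A))).
      by rewrite take_uniq ?finmap.fset_uniq//; split=> //; rewrite size_takel.
    by move=> x /= /mem_take; rewrite in_fset_set// inE.
  by apply: uniq_leq_size => // x xs; rewrite in_fset_set// inE; exact: sA.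
split=> _; last by rewrite leey.
have [B BA jB] := infinite_set_fset j iA.
exists (take j (finmap.enum_fset B)).
  by rewrite take_uniq ?finmap.fset_uniq//; split=> //; rewrite size_takel.
by move=> x /= /mem_take xB; exact: BA.
Qed.

Lemma ncells_le_counting k A : ((ncells k A)%:R%:E <= counting A :> \bar R)%E.
Proof.
apply/counting_geP.
have /choice[f fP] : forall b : {ffun 'I_k -> bool},
    exists x, A `&` cell k b !=set0 -> (A `&` cell k b) x.
  move=> b; have [[x xb]|nb] := pselect (A `&` cell k b !=set0); first by exists x.
  by exists point => /nb.
set bs := enum [pred b : {ffun 'I_k -> bool} | `[< A `&` cell k b !=set0 >]].
have fbs b : b \in bs -> (A `&` cell k b) (f b).
  by rewrite mem_enum => /asboolP/fP.
exists (map f bs).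
  rewrite size_map -cardE; split=> //; rewrite map_inj_in_uniq ?enum_uniq//.
  by move=> b b' /fbs[_ fb] /fbs[_ fb'] bb'; rewrite -fb -fb' bb'.
by move=> x /= /mapP[b /fbs[Afb _] ->].
Qed.

Lemma counting_le_ncells Y A (j : nat) : A `<=` Y ->
  (j%:R%:E <= counting A :> \bar R)%E -> exists k, (j <= ncells k A)%N.
Proof.
move=> AY /counting_geP[s [us <-] sA].
have [k sk] : exists k, {in s &, injective (cell_of k)}.
  have : \forall k \near \oo, forall x, x \in s ->
      forall y, Defs.support Y y -> cell_of k y = cell_of k x -> y = x.
    elim: s {us sA} => [|z s IH]; first exact: nearW.
    near=> k => y; rewrite inE => /predU1P[->|ys].
      by near: k; exact: cells_isolate.
    by move: y ys; near: k.
  move=> [k _ sk]; exists k => x y xs ys xy.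
  by apply: (sk k (leqnn _)) => //; exact/AY/sA.
exists k; rewrite /ncells cardE -(size_map (cell_of k)).
apply: uniq_leq_size; first by rewrite map_inj_in_uniq.
move=> _ /mapP[x xs ->]; rewrite mem_enum; apply/asboolP; exists x.
by split=> //; exact: sA.
Unshelve. all: by end_near. Qed.

Lemma counting_esups Y A : A `<=` Y ->
  counting A = esups (fun k => (ncells k A)%:R%:E : \bar R) 0%N.
Proof.
move=> AY; rewrite /esups /=; apply/eqP; rewrite eq_le; apply/andP; split.
  have ub j : (j%:R%:E <= counting A :> \bar R)%E ->
      (j%:R%:E <= ereal_sup (sdrop (fun k => (ncells k A)%:R%:E : \bar R) 0%N))%E.
    move=> /(counting_le_ncells _ _ _ AY)[k jk].
    apply: (@le_trans _ _ (ncells k A)%:R%:E); first by rewrite lee_fin ler_nat.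
    by apply: ereal_sup_ubound; exists k.
  have [cA|[j cA]] : counting A = +oo%E :> \bar R \/
      exists j : nat, counting A = j%:R%:E :> \bar R.
    by rewrite /counting; case: asboolP => fA; [right; eexists|left].
  - have {}ub j := ub j (eq_ind_r (fun c => _ <= c)%E (leey _) cA).
    rewrite cA; case: (ereal_sup _) ub => [r||] ub //; last by have := ub 0%N.
    have := ub (Num.truncn r).+1; rewrite lee_fin leNgt.
    by rewrite (truncnS_gt r).
  - by rewrite cA; apply: ub; rewrite cA.
apply: ge_ereal_sup => _ [k _ <-]; exact: (ncells_le_counting k A).
Qed.

End cells.

(** * Avoidance events *)

Section void_events.
Context {R : realType} {n : nat}.
Implicit Types (x y : n.-tuple R) (A B : set (n.-tuple R)) (Y : locfin R n).

Lemma lebesgue_tuple_le A B : measurable A -> measurable B -> A `<=` B ->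
  (lebesgue_tuple A <= lebesgue_tuple B)%E.
Proof.
have [mu <-] := lebesgue_tuple_sigma_finite R n.
by move=> mA mB; apply: le_measure; rewrite inE.
Qed.

Lemma lebesgue_tuple_ge0 A : measurable A -> (0 <= lebesgue_tuple A)%E.
Proof.
have [mu <-] := lebesgue_tuple_sigma_finite R n.
by move=> mA; exact: measure_ge0.
Qed.

Lemma lebesgue_tuple0 : lebesgue_tuple (set0 : set (n.-tuple R)) = 0%E.
Proof. by have [mu <-] := lebesgue_tuple_sigma_finite R n; exact: measure0. Qed.

Lemma lebesgue_tupleU_fin A B : measurable A -> measurable B ->
  (lebesgue_tuple A < +oo)%E -> (lebesgue_tuple B < +oo)%E ->
  (lebesgue_tuple (A `|` B) < +oo)%E.
Proof.
have [mu <-] := lebesgue_tuple_sigma_finite R n.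
move=> mA mB Aoo Boo; apply: le_lt_trans (measureU2 _ mA mB) _.
exact: lte_add_pinfty.
Qed.

Lemma lebesgue_tuple_cube (N : R) : 0 <= N ->
  lebesgue_tuple (box N : set (n.-tuple R)) = ((2 * N) ^+ n)%:E.
Proof.
move=> N0; rewrite lebesgue_tuple_box; last by move=> _; rewrite ge0_cp.
congr EFin; rewrite (eq_bigr (fun=> 2 * N)) ?prodr_const ?card_ord//.
by move=> i _; ring.
Qed.

Lemma set1_box x : [set x] = [set y | forall i, tnth x i <= tnth y i <= tnth x i].
Proof.
apply/seteqP; split=> [y -> i|y xy] /=; first by rewrite lexx.
by apply: eq_from_tnth => i; apply/eqP; rewrite eq_le andbC.
Qed.

Lemma lebesgue_tuple_set1 x : (0 < n)%N -> lebesgue_tuple [set x] = 0%E.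
Proof.
move=> n0; rewrite set1_box lebesgue_tuple_box//.
by rewrite (bigD1 (Ordinal n0))//= subrr mul0r.
Qed.

Definition avoiding B : set (locfin R n) := [set Y : locfin R n | Y `&` B = set0].

(** Restricted to finite volume, where the Poisson hypothesis prescribes probabilities. *)
Definition void_events : set (set (locfin R n)) :=
  [set V | exists B, [/\ measurable B, (lebesgue_tuple B < +oo)%E & V = avoiding B]].

Lemma counting_eq0 A : (counting A = 0 :> \bar R) <-> A = set0.
Proof.
split=> [|->]; last first.
  by rewrite /counting asboolT// fset_set0.
rewrite /counting; case: asboolP => // fA [/eqP].
by rewrite pnatr_eq0 finmap.cardfs_eq0 => /eqP /fset_set_set0 ->.
Qed.

Lemma measurable_countP B (V : set (\bar R)) : measurable B -> measurable V ->
  measurable [set Y : locfin R n | V (counting (Y `&` B))].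
Proof.
by move=> mB mV; apply: sub_sigma_algebra; exists B, V.
Qed.

Lemma measurable_avoiding B : measurable B -> measurable (avoiding B).
Proof.
move=> mB; rewrite (_ : avoiding B = [set Y : locfin R n | [set 0%E : \bar R] (counting (Y `&` B))]).
  exact: measurable_countP.
by apply/seteqP; split=> Y /= /counting_eq0.
Qed.

(* The number of points in B is the supremum over k of the number of occupied
   cells of level k, hence a function of avoidance events. *)
Lemma measurable_locfinE : measurable = <<s void_events>>.
Proof.
apply/seteqP; split; last first.
  apply: smallest_sub; first exact: sigma_algebra_measurable.
  by move=> _ [B [mB _ ->]]; exact: measurable_avoiding.
pose GT := g_sigma_algebraType void_events.
apply: smallest_sub; first exact: smallest_sigma_algebra.
move=> _ [B [V [mB mV ->]]].
have mvoidC B' : measurable B' -> measurable (~` avoiding B' : set GT).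
  move=> mB'.
  (* The generators require finite volume, so a general Borel set is exhausted by cubes. *)
  rewrite (_ : ~` _ = \bigcup_(N : nat) ~` avoiding (B' `&` box N%:R)).
    apply: bigcupT_measurable => N; apply: measurableC; apply: sub_sigma_algebra.
    have mbox := measurable_cube (N%:R : R) (n := n).
    exists (B' `&` box N%:R); split=> //; first exact: measurableI.
    apply: le_lt_trans (lebesgue_tuple_le _ _ _ mbox _) _ => //.
      exact: measurableI.
    by rewrite lebesgue_tuple_cube// ltry.
  apply/seteqP; split=> [Y /eqP/set0P[y [Yy By]]|Y [N _ YN] Y0].
    have [N yN] := box_natP y; exists N => //; apply/eqP/set0P.
    by exists y.
  by apply: YN; rewrite /avoiding /= setIA Y0 set0I.
have mcount : measurable_fun setT (fun Y : GT => counting (Y `&` B) : \bar R).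
  rewrite (_ : (fun _ => _) = (fun Y : GT =>
      esups (fun k => (ncells k (Y `&` B))%:R%:E : \bar R) 0%N)); last first.
    by apply/funext => Y; apply: (counting_esups Y); exact: subIsetl.
  apply: (measurable_fun_esups (f := fun k (Y : GT) =>
    (ncells k (Y `&` B))%:R%:E : \bar R)) => k.
  apply: measurableT_comp => //.
  rewrite (_ : (fun _ => _) = (fun Y : GT => \sum_(b : {ffun 'I_k -> bool})
      (\1_(~` avoiding (B `&` cell k b)) Y : R))).
    apply: measurable_sum => b; apply: measurable_indic; apply: mvoidC.
    by apply: measurableI => //; exact: measurable_cell.
  apply/funext => Y; rewrite /ncells -sum1_card big_mkcond natr_sum /=.
  apply: eq_bigr => b _; rewrite indicE inE.
  case: asboolP => [YB|YB]; rewrite -setIA in YB.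
    by rewrite mem_set//; exact/eqP/set0P.
  rewrite memNset// => /eqP/set0P; exact: YB.
rewrite -[X in <<s _>> X]setTI; exact: mcount.
Qed.

Lemma measurable_locfinP {d} {T : measurableType d} (g : T -> locfin R n) :
  (forall B, measurable B -> measurable [set t | g t `&` B = set0]) ->
  measurable_fun setT g.
Proof.
move=> mg; apply: (measurability void_events measurable_locfinE).
by move=> _ [_ [B [mB _ ->]] <-]; rewrite setTI; exact: mg.
Qed.

(** Avoiding B and avoiding B' together is avoiding their union, so the generating events form a
    pi-system; avoiding the empty set is the whole space. *)
Lemma void_measure_unique (p q : probability (locfin R n) R) :
  (forall B, measurable B -> (lebesgue_tuple B < +oo)%E -> p (avoiding B) = q (avoiding B)) ->
  forall V : set (locfin R n), measurable V -> p V = q V.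
Proof.
move=> pq; apply: (measure_unique void_events (fun=> setT)) => //.
- exact: measurable_locfinE.
- move=> _ _ [B [mB Boo ->]] [B' [mB' B'oo ->]]; exists (B `|` B').
  split; [exact: measurableU|exact: lebesgue_tupleU_fin|].
  apply/seteqP; split=> Y; rewrite /avoiding /= setIUr.
    by move=> [-> ->]; rewrite setU0.
  by rewrite setU_eq0.
- move=> _; exists set0; split=> //; first by rewrite lebesgue_tuple0.
  by apply/seteqP; split=> Y _ //; rewrite /avoiding /= setI0.
- by apply/seteqP; split=> // Y _; exists 0%N.
- by move=> _ [B [mB Boo ->]]; exact: pq.
- by move=> _; rewrite [X in (X < _)%E]probability_setT ltry.
Qed.

Lemma measurable_locfinU :
  measurable_fun setT (fun z : locfin R n * locfin R n => locfinU z.1 z.2).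
Proof.
apply: measurable_locfinP => B mB.
rewrite (_ : [set _ | _] = avoiding B `*` avoiding B).
  by apply: measurableX; exact: measurable_avoiding.
apply/seteqP; split=> -[U V] /=; rewrite /avoiding /= setIUl.
  by rewrite setU_eq0.
by move=> [-> ->]; rewrite setU0.
Qed.

Lemma locally_finiteD Y A : locally_finite (Y `\` A).
Proof.
by move=> r; apply: sub_finite_set (locfinP Y r) => z [[Yz _] rz]; split.
Qed.

Definition locfinD Y A : locfin R n := Locfin (locally_finiteD Y A).

Lemma measurable_locfinD A : measurable A -> measurable_fun setT (locfinD ^~ A).
Proof.
move=> mA; apply: measurable_locfinP => B mB.
rewrite (_ : [set _ | _] = avoiding (B `\` A)).
  by apply: measurable_avoiding; exact: measurableD.
by apply/seteqP; split=> Y; rewrite /avoiding /= !setDE -!setIA [~` A `&` _]setIC.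
Qed.

Lemma locfin_ext Y Y' : Y = Y' :> set (n.-tuple R) -> Y = Y'.
Proof.
case: Y Y' => [Y fY] [Y' fY'] /= E; move: fY fY'; rewrite E => fY fY'.
by congr Locfin; exact: Prop_irrelevance.
Qed.

End void_events.

(** * Poisson laws *)

Section poisson_laws.
Context {R : realType} {n : nat}.
Implicit Types (x y : n.-tuple R) (A B : set (n.-tuple R)) (Y : locfin R n).
Implicit Types (p q r : probability (locfin R n) R).

(** For mu = 0 this is the Dirac mass at the empty configuration, the unit of the semigroup of
    laws. *)
Definition poisson_law (mu : R) p := forall B, measurable B ->
  (lebesgue_tuple B < +oo)%E ->
  p (avoiding B) = (expR (- (mu * fine (lebesgue_tuple B))))%:E.

Definition two_points B : set (locfin R n) :=
  [set Y : locfin R n | (2%:R%:E <= counting (Y `&` B) :> \bar R)%E].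

(** Carried along with [poisson_law] instead of being derived from avoidance probabilities: it is
    read off the count distribution of a given process and transported by stretching. *)
Definition rare_two_points (mu : R) p := forall B, measurable B ->
  (lebesgue_tuple B < +oo)%E ->
  (p (two_points B) <= ((mu * fine (lebesgue_tuple B)) ^+ 2)%:E)%E.

Lemma measurable_two_points B : measurable B -> measurable (two_points B).
Proof.
move=> mB; pose V : set (\bar R) := [set` `[2%:R%:E, +oo[%O].
rewrite (_ : two_points B = [set Y : locfin R n | V (counting (Y `&` B))]).
  by apply: measurable_countP => //; exact: emeasurable_itv.
by apply/seteqP; split=> Y; rewrite /two_points /V /= in_itv/= andbT.
Qed.

Lemma Rint_dirac Y (g : locfin R n -> R) : bounded_measurable g ->
  \int[\d_Y]_x g x = g Y.
Proof.
move=> [mg _]; rewrite /Rintegral integral_dirac//; first by rewrite diracT mul1e.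
exact/measurable_EFinP.
Qed.

Lemma poisson_law0 : poisson_law 0 (\d_(point : locfin R n)).
Proof.
move=> B mB Boo; rewrite mul0r oppr0 expR0 /= diracE mem_set//.
by rewrite /avoiding /= set0I.
Qed.

Lemma rare_two_points0 : rare_two_points 0 (\d_(point : locfin R n)).
Proof.
move=> B mB Boo; rewrite /= diracE memNset; first by rewrite lee_fin sqr_ge0.
by rewrite /two_points /= set0I measure0 lee_fin leNgt ltr0n.
Qed.

Lemma poisson_law_unique {mu p q} : poisson_law mu p -> poisson_law mu q ->
  forall V : set (locfin R n), measurable V -> p V = q V.
Proof.
by move=> pp qq; apply: void_measure_unique => B mB Boo; rewrite pp// qq.
Qed.

Lemma poisson_law_Rint {mu p q} : poisson_law mu p -> poisson_law mu q ->
  forall g : locfin R n -> R, \int[p]_x g x = \int[q]_x g x.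
Proof.
move=> pp qq g; congr fine; apply: eq_measure_integral => V mV _.
exact: (poisson_law_unique pp qq).
Qed.

Lemma poisson_law_superposition {mu nu p q r} :
  poisson_law mu p -> poisson_law nu q -> poisson_law (mu + nu) r ->
  forall g : locfin R n -> R, bounded_measurable g ->
  \int[r]_z g z = \int[p]_u \int[q]_v g (locfinU u v).
Proof.
move=> pp qq rr g bg.
pose U (z : locfin R n * locfin R n) := locfinU z.1 z.2.
have mU : measurable_fun setT U by exact: measurable_locfinU.
pose Um := isMeasurableFun.Build _ _ _ _ _ mU.
pose U' : {mfun _ >-> _} := HB.pack U Um.
pose pq := distribution (p \x q)%E U'.
have pqE : poisson_law (mu + nu) pq.
  move=> B mB Boo; transitivity ((p \x q)%E (U @^-1` avoiding B)) => //.
  rewrite (_ : _ @^-1` _ = avoiding B `*` avoiding B); last first.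
    apply/seteqP; split=> -[u v] /=; rewrite /avoiding /= setIUl.
      by rewrite setU_eq0.
    by move=> [-> ->]; rewrite setU0.
  have mV := measurable_avoiding B mB.
  transitivity (p (avoiding B) * q (avoiding B))%E; first exact: product_measure1E.
  by rewrite pp// qq// -EFinM -expRD -opprD -mulrDl.
rewrite (poisson_law_Rint rr pqE).
have bgU : bounded_measurable (fun z => g (U z)) by exact: bm_comp bg mU.
have igU := bm_integrable (p \x q)%E bgU.
rewrite /pq /Rintegral integral_distribution//; last first.
  by apply/measurable_EFinP; case: bg.
rewrite -(integral12_prod_meas1 igU); congr fine; apply: eq_integral => u _.
rewrite /fubini_F -EFin_Rintegral//.
exact: (bm_pair2 (fun u v => g (locfinU u v)) bgU).
Qed.

Lemma poisson_prob1E (rate : R) (k : nat) : 0 <= rate ->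
  poisson_prob rate 0 [set k] = (rate ^+ k / k`!%:R * expR (- rate))%:E.
Proof.
rewrite le_eqVlt /poisson_prob => /predU1P[<-|rate0].
  rewrite ltxx oppr0 expR0 mulr1 diracE; case: k => [|k].
    by rewrite mem_set// expr0 divr1.
  by rewrite memNset// expr0n mul0r.
by rewrite rate0 esum_set1 ?lee_fin ?poisson_pmf_ge0// /poisson_pmf rate0.
Qed.

Lemma distribution_poisson_law {d} {T : measurableType d} {P : probability T R}
    {lambda : R} {X : {RV P >-> locfin R n}} : 0 < lambda ->
  stationary_poisson_process lambda X -> poisson_law lambda (distribution P X).
Proof.
move=> lambda0 [hX _] B mB Boo.
have := hX B mB Boo 0%N; rewrite poisson_prob1E; last first.
  by apply: mulr_ge0; [exact: ltW|exact/fine_ge0/lebesgue_tuple_ge0].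
rewrite expr0 fact0 divr1 mul1r => <-; congr (P _).
by apply/seteqP; split=> w /=; rewrite /avoiding /= counting_eq0.
Qed.

(** Multiply exp(-t) >= 1 - t by 1 + t. *)
Lemma two_points_bound (t : R) : 0 <= t ->
  1 - (expR (- t) + t * expR (- t)) <= t ^+ 2.
Proof.
move=> t0; have := expR_ge1Dx (- t); have := expR_gt0 (- t).
set e := expR _ => e0 e1.
suff : (1 + t) * (1 - t) <= (1 + t) * e by lra.
by rewrite ler_pM2l; lra.
Qed.

Lemma distribution_rare_two_points {d} {T : measurableType d} {P : probability T R}
    {lambda : R} {X : {RV P >-> locfin R n}} : 0 < lambda ->
  stationary_poisson_process lambda X ->
  rare_two_points lambda (distribution P X).
Proof.
move=> lambda0 [hX _] B mB Boo; set t := lambda * _.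
have t0 : 0 <= t.
  by apply: mulr_ge0; [exact: ltW|exact/fine_ge0/lebesgue_tuple_ge0].
apply: le_trans (_ : (1 - (expR (- t) + t * expR (- t)))%:E <= _)%E; last first.
  by rewrite lee_fin two_points_bound.
pose N k := [set w | counting (X w `&` B) = k%:R%:E :> \bar R].
have mN k : measurable (N k).
  have mC := measurable_countP B [set k%:R%:E] mB (emeasurable_set1 _).
  exact: (measurable_funPTI X mC).
have PN k : P (N k) = (t ^+ k / k`!%:R * expR (- t))%:E.
  by rewrite hX// poisson_prob1E.
rewrite [leLHS](_ : _ = P (~` (N 0%N `|` N 1%N))); last first.
  congr (P _).
  apply/seteqP; split=> w; rewrite /two_points /N /=.
    by move=> le2 [] E; move: le2; rewrite E lee_fin ler_nat.
  move=> /not_orP[N0 N1]; move: N0 N1; rewrite /counting; case: asboolP => [_|]; last first.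
    by rewrite leey.
  by case: (size _) => [|[|k]] // _ _; rewrite lee_fin ler_nat.
have PU : P (N 0%N `|` N 1%N) = (expR (- t) + t * expR (- t))%:E.
  transitivity (P (N 0%N) + P (N 1%N))%E.
    apply: measureU => //; apply/seteqP; split=> // w; rewrite /N /= => -[-> [/eqP]].
    by rewrite eqr_nat.
  by rewrite !PN expr0 fact0 divr1 mul1r expr1 divr1.
by rewrite probability_setC ?PU//; exact: measurableU.
Qed.

End poisson_laws.

(** * Poisson laws of every intensity from one given process *)

Section stretched_process.
Context {R : realType} {n : nat}.
Implicit Types (x y : n.-tuple R) (A B : set (n.-tuple R)) (Y : locfin R n).

Lemma euclidean_norm_ge x i : `|tnth x i| <= euclidean_norm x.
Proof.
rewrite -sqrtr_sqr /euclidean_norm ler_sqrt; last first.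
  by apply: sumr_ge0 => j _; rewrite sqr_ge0.
by rewrite (bigD1 i)//= lerDl sumr_ge0// => j _; rewrite sqr_ge0.
Qed.

Lemma locally_finite_stretch (s : R) Y : 0 < s -> locally_finite (stretch R n s @` Y).
Proof.
move=> s0 r; apply: sub_finite_set
  (finite_image (stretch R n s) (locfin_box Y (`|r| + `|r| / s))).
move=> _ [[x Yx <-] /= sxr]; exists x => //; split=> // i.
rewrite -ler_norml.
have := le_trans (le_trans (euclidean_norm_ge _ i) sxr) (ler_norm r).
rewrite tnth_mktuple normrM; case: ifP => _.
  rewrite (gtr0_norm s0) => h; apply: (@le_trans _ _ (`|r| / s)).
    by rewrite ler_pdivlMr// mulrC.
  by rewrite lerDr.
rewrite normr1 mul1r => h; apply: le_trans h _.
by rewrite lerDl divr_ge0// ltW.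
Qed.

Definition locfin_stretch (s : R) (s0 : 0 < s) Y : locfin R n :=
  Locfin (locally_finite_stretch s Y s0).

Lemma measurable_stretch_preimage (s : R) B :
  measurable B -> measurable (stretch R n s @^-1` B).
Proof.
by move=> mB; rewrite -[X in measurable X]setTI; exact: measurable_stretch.
Qed.

Lemma avoiding_stretch (s : R) (s0 : 0 < s) B :
  locfin_stretch s s0 @^-1` avoiding B = avoiding (stretch R n s @^-1` B).
Proof.
apply/seteqP; split=> Y; rewrite /avoiding /= => YB; apply/seteqP; split=> // y.
  move=> [Yy By]; suff : set0 (stretch R n s y) by [].
  by rewrite -YB; split=> //; exists y.
by move=> [[x Yx <-] Bx]; suff : set0 x by []; rewrite -YB.
Qed.

Lemma two_points_stretch (s : R) (s0 : 0 < s) B :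
  locfin_stretch s s0 @^-1` two_points B `<=` two_points (stretch R n s @^-1` B).
Proof.
move=> Y /counting_geP[t [ut t2] tY]; apply/counting_geP.
have /choice[f fP] : forall y, exists x, y \in t -> Defs.support Y x /\ stretch R n s x = y.
  move=> y; have [yt|_] := boolP (y \in t); last by exists point.
  by have [[x Yx xy] _] := tY _ yt; exists x.
exists (map f t).
  rewrite size_map t2; split=> //; rewrite map_inj_in_uniq//.
  by move=> y y' /fP[_ fy] /fP[_ fy'] ff; rewrite -[y]fy ff fy'.
move=> _ /= /mapP[y yt ->]; have [Yfy fy] := fP _ yt.
by split=> //=; rewrite fy; have [] := tY _ yt.
Qed.

(* Stretching the first coordinate by s turns intensity lambda into lambda/s. *)
Lemma exists_poisson_law {d} {T : measurableType d} {P : probability T R}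
    {lambda : R} {X : {RV P >-> locfin R n}} (mu : R) :
  (0 < n)%N -> 0 < lambda -> 0 <= mu -> stationary_poisson_process lambda X ->
  exists p : probability (locfin R n) R, poisson_law mu p /\ rare_two_points mu p.
Proof.
move=> n0 lambda0; rewrite le_eqVlt => /predU1P[<- _|mu0 hX].
  by exists (\d_(point : locfin R n)); split; [exact: poisson_law0|exact: rare_two_points0].
have s0 : 0 < lambda / mu by rewrite divr_gt0.
set s := lambda / mu in s0.
pose q := distribution P X.
have mst : measurable_fun setT (locfin_stretch s s0).
  apply: measurable_locfinP => B mB.
  rewrite (_ : [set _ | _] = locfin_stretch s s0 @^-1` avoiding B)//.
  rewrite avoiding_stretch.
  exact: (measurable_avoiding _ (measurable_stretch_preimage s B mB)).
pose st : {mfun locfin R n >-> locfin R n} :=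
  HB.pack (locfin_stretch s s0) (isMeasurableFun.Build _ _ _ _ _ mst).
have rate B : measurable B -> (lebesgue_tuple B < +oo)%E ->
    (lebesgue_tuple (stretch R n s @^-1` B) < +oo)%E /\
    lambda * fine (lebesgue_tuple (stretch R n s @^-1` B)) =
    mu * fine (lebesgue_tuple B).
  move=> mB Boo; have Bfin : lebesgue_tuple B \is a fin_num.
    by rewrite ge0_fin_numE// lebesgue_tuple_ge0.
  rewrite lebesgue_tuple_stretch//; split.
    by rewrite -(fineK Bfin) -EFinM ltry.
  rewrite fineM// mulrA; congr (_ * _).
  by rewrite /s invf_div mulrCA divff ?mulr1// gt_eqF.
exists (distribution q st); split=> B mB Boo; have [sBoo sB] := rate B mB Boo.
  rewrite -sB -(distribution_poisson_law lambda0 hX)//; last first.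
    exact: measurable_stretch_preimage.
  by rewrite -(avoiding_stretch s s0).
rewrite -sB; apply: le_trans (distribution_rare_two_points lambda0 hX _ _ sBoo).
  have mS := measurable_two_points _ (measurable_stretch_preimage s B mB).
  have mP : measurable (locfin_stretch s s0 @^-1` two_points B) :=
    measurable_funPTI st (measurable_two_points _ mB).
  exact: (le_measure q (mem_set mP) (mem_set mS) (two_points_stretch s s0 B)).
exact: measurable_stretch_preimage.
Qed.

Lemma finite_set_null A : (0 < n)%N -> finite_set A ->
  measurable A /\ lebesgue_tuple A = 0%E.
Proof.
move=> n0 /finite_seqP[s ->]; elim: s => [|x s [ms s0]].
  by rewrite set_nil lebesgue_tuple0.
have mx : measurable [set x] by rewrite set1_box; exact: measurable_box.
have mxs : measurable ([set x] `|` [set` s]) by exact: measurableU.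
rewrite (_ : [set` x :: s] = [set x] `|` [set` s]); last first.
  by apply/seteqP; split=> y /=; rewrite inE => /predU1P.
split=> //.
have [mu muE] := lebesgue_tuple_sigma_finite R n.
apply/eqP; rewrite eq_le lebesgue_tuple_ge0// andbT.
rewrite -muE in s0 *.
apply: (@le_trans _ _ (mu [set x] + mu [set` s])%E); first exact: measureU2.
by rewrite s0 muE lebesgue_tuple_set1// adde0.
Qed.

(** Superposition is a union of sets: if V shared a point x with Y, deleting x from the union would
    damage Y. Finite sets are null because n > 0, and cubes reduce a locally finite Y to countably
    many finite sets. *)
Lemma poisson_law_ae_disjoint (mu : R) (p : probability (locfin R n) R) Y :
  (0 < n)%N -> poisson_law mu p -> {ae p, forall V : locfin R n, V `&` Y = set0}.
Proof.
move=> n0 pp.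
have null N : p (~` avoiding (Y `&` box N%:R)) = 0%E.
  have [mN LN] := finite_set_null _ n0 (locfin_box Y N%:R).
  have mA := measurable_avoiding _ mN.
  have LNoo : (lebesgue_tuple (Y `&` box N%:R) < +oo)%E by rewrite LN ltry.
  have := probability_setC p mA.
  by rewrite (pp _ mN LNoo) LN mulr0 oppr0 expR0 subee.
have : p.-negligible (\bigcup_N ~` avoiding (Y `&` box N%:R)).
  apply: negligible_bigcup => N.
  have [mN _] := finite_set_null _ n0 (locfin_box Y N%:R).
  have mA := measurableC (measurable_avoiding _ mN).
  exact: (iffRL (negligibleP _ mA) (null N)).
apply: negligibleS => V /= VY; apply: contrapT => nV; apply: VY.
apply/seteqP; split=> // x [Vx Yx]; have [N xN] := box_natP x.
apply: nV; exists N => //= V0; suff : set0 x by [].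
by rewrite -V0.
Qed.

End stretched_process.

(** * The effect of one additional piece *)

Section add_one_point.
Context {R : realType} {n : nat}.
Implicit Types (x y : n.-tuple R) (A B c : set (n.-tuple R)).
Implicit Types (U V Y Z : locfin R n) (p q r : probability (locfin R n) R).

Lemma locfinUA : associative (@locfinU R n).
Proof. by move=> U V W; apply: locfin_ext; rewrite /= setUA. Qed.

Lemma locfinUC : commutative (@locfinU R n).
Proof. by move=> U V; apply: locfin_ext; rewrite /= setUC. Qed.

Lemma locfin0U : left_id (point : locfin R n) (@locfinU R n).
Proof. by move=> U; apply: locfin_ext; rewrite /= set0U. Qed.

Definition one_point c : set (locfin R n) :=
  [set Y : locfin R n | counting (Y `&` c) = 1%:E :> \bar R].

Lemma measurable_one_point c : measurable c -> measurable (one_point c).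
Proof.
by move=> mc; exact: (measurable_countP c [set 1%:E] mc (emeasurable_set1 _)).
Qed.

Lemma one_pointP c Y : one_point c Y -> exists x, Y `&` c = [set x].
Proof.
rewrite /one_point /counting /=; case: asboolP => // fA [/eqP].
rewrite -[1]/(1%:R) eqr_nat => /eqP/eqP/finmap.cardfs1P[x Yx]; exists x.
by rewrite -(fset_setK fA) Yx; apply/seteqP; split=> y /=; rewrite inE => /eqP.
Qed.

Lemma one_point_set1 c Y x : Y `&` c = [set x] -> one_point c Y.
Proof.
move=> Yc; rewrite /one_point /= Yc /counting asboolT//.
by rewrite fset_set1 finmap.cardfs1.
Qed.

Lemma avoiding_locfinU c U V :
  (\1_(avoiding c) (locfinU U V) : R) = \1_(avoiding c) U * \1_(avoiding c) V.
Proof.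
rewrite !indicE -natrM mulnb; congr (_%:R); congr nat_of_bool.
by apply/idP/andP => [|[]]; rewrite !inE /avoiding /= setIUl setU_eq0.
Qed.

Lemma one_point_locfinU c U V :
  \1_(one_point c) U * \1_(avoiding c) V + \1_(avoiding c) U * \1_(one_point c) V
  <= \1_(one_point c) (locfinU U V) :> R.
Proof.
have excl Y : one_point c Y -> ~ avoiding c Y.
  move=> /one_pointP[x Yx]; rewrite /avoiding /= Yx => x0.
  by have : set0 x by rewrite -x0.
rewrite !indicE -!natrM -natrD ler_nat !mulnb.
have [U1|U1] := asboolP (one_point c U); have [V0|V0] := asboolP (avoiding c V);
  have [U0|U0] := asboolP (avoiding c U); have [V1|V1] := asboolP (one_point c V);
  rewrite ?(mem_set U1) ?(mem_set V0) ?(mem_set U0) ?(mem_set V1)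
    ?(memNset U1) ?(memNset V0) ?(memNset U0) ?(memNset V1) //=;
  try (by have := excl _ U1); try (by have := excl _ V1).
- rewrite mem_set//; have [x Ux] := one_pointP _ _ U1.
  by apply: (@one_point_set1 _ _ x); rewrite /= setIUl Ux V0 setU0.
- rewrite mem_set//; have [x Vx] := one_pointP _ _ V1.
  by apply: (@one_point_set1 _ _ x); rewrite /= setIUl Vx U0 set0U.
Qed.

Variable S : locfin R n -> R.
Hypothesis bS : bounded_measurable S.

(** Deleting a cell is a measurable operation on configurations; if Z has exactly one point x in c,
    the result is the summand of x. *)
Definition cell_gain c Z := (S (locfinD Z c) - S Z) ^+ 2.

Lemma bm_cell_gain c : measurable c -> bounded_measurable (cell_gain c).
Proof.
move=> mc; apply: bmX; apply: bmD; last exact: bmN.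
exact: (bm_comp bS (measurable_locfinD c mc)).
Qed.

Definition isolated_gain k Z : R :=
  \sum_(b : {ffun 'I_k -> bool}) \1_(one_point (cell k b)) Z * cell_gain (cell k b) Z.

(** The part of [isolated_gain] at the union that is due to points of V in cells where U has
    none. *)
Definition new_isolated_gain k U V : R :=
  \sum_(b : {ffun 'I_k -> bool}) \1_(avoiding (cell k b)) U *
    \1_(one_point (cell k b)) V * cell_gain (cell k b) (locfinU U V).

Lemma bm_isolated_gain k : bounded_measurable (isolated_gain k).
Proof.
apply: bm_sum => b; have mb := measurable_cell k b; apply: bmM.
  by apply: bm_indic; exact: measurable_one_point.
exact: bm_cell_gain.
Qed.

Lemma bm_new_cell_gain c : measurable c -> bounded_measurable
  (fun z : locfin R n * locfin R n => \1_(avoiding c) z.1 *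
    \1_(one_point c) z.2 * cell_gain c (locfinU z.1 z.2)).
Proof.
move=> mc; have m0 := bm_indic (R := R) (measurable_avoiding c mc).
have m1 := bm_indic (R := R) (measurable_one_point c mc).
apply: bmM; first apply: bmM.
- exact: (bm_comp m0 measurable_fst).
- exact: (bm_comp m1 measurable_snd).
- exact: (bm_comp (bm_cell_gain c mc) measurable_locfinU).
Qed.

Lemma bm_new_isolated_gain k :
  bounded_measurable (fun z => new_isolated_gain k z.1 z.2).
Proof.
apply: bm_sum => b.
exact: (bm_new_cell_gain (cell k b) (measurable_cell k b)).
Qed.

Lemma isolated_gain_ge0 k Z : 0 <= isolated_gain k Z.
Proof. by apply: sumr_ge0 => b _; apply: mulr_ge0; [rewrite indicE ler0n|exact: sqr_ge0]. Qed.

Lemma new_isolated_gain_ge0 k U V : 0 <= new_isolated_gain k U V.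
Proof. by apply: sumr_ge0 => b _; apply: mulr_ge0; [apply: mulr_ge0; rewrite indicE ler0n|exact: sqr_ge0]. Qed.

(** Different cells are disjoint, so their lone points are distinct and the left side is a finite
    partial sum of the right one. *)
Lemma isolated_gain_le_esum k Z : ((isolated_gain k Z)%:E <=
  \esum_(x in Z) ((S (locfinD1 Z x) - S Z) ^+ 2)%:E)%E.
Proof.
pose bs := [seq b <- index_enum {ffun 'I_k -> bool} | `[< one_point (cell k b) Z >]].
have /choice[f fP] : forall b : {ffun 'I_k -> bool}, exists x,
    one_point (cell k b) Z -> Z `&` cell k b = [set x].
  move=> b; have [/one_pointP[x Zx]|n1] := pselect (one_point (cell k b) Z).
    by exists x.
  by exists point => /n1.
have fcell b : one_point (cell k b) Z -> Defs.support Z (f b) /\ cell_of k (f b) = b.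
  by move=> /fP Zb; have : [set f b] (f b) by []; rewrite -Zb => -[].
have ubs : uniq bs by rewrite filter_uniq// index_enum_uniq.
have us : uniq (map f bs).
  rewrite map_inj_in_uniq// => b b'; rewrite !mem_filter.
  move=> /andP[/asboolP/fcell[_ eb] _] /andP[/asboolP/fcell[_ eb'] _] ff.
  by rewrite -eb -eb' ff.
apply: esum_ge; exists [set` map f bs].
  split; first exact: finite_seq.
  move=> _ /= /mapP[b + ->]; rewrite mem_filter => /andP[/asboolP/fcell[Zf _] _].
  exact: Zf.
rewrite -fsbig_seq// big_map sumEFin lee_fin /isolated_gain.
rewrite (bigID (fun b => `[< one_point (cell k b) Z >])) /=.
rewrite [X in _ + X]big1 ?addr0; last first.
  by move=> b /asboolP nb; rewrite indicE memNset// mul0r.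
rewrite [leRHS]big_filter; apply: ler_sum => b /asboolP Zb.
rewrite indicE mem_set// mul1r /cell_gain.
rewrite (_ : locfinD Z (cell k b) = locfinD1 Z (f b))//.
apply: locfin_ext => /=; have Zf := fP b Zb.
apply/seteqP; split=> y [Zy ny]; split=> //.
  move=> yf; apply: ny; have : [set f b] y by [].
  by rewrite -Zf => -[].
by move=> yb; apply: ny; have : (Z `&` cell k b) y by []; rewrite Zf.
Qed.

End add_one_point.

(** * Lower limits and integrals in the extended reals *)

Section einf_bounds.
Context {R : realType}.
Implicit Types (u : (\bar R)^nat) (x : \bar R).
Local Open Scope ereal_scope.

Lemma limn_einf_ge u x : (\forall k \near \oo, x <= u k) -> x <= limn_einf u.
Proof.
move=> [N _ xu]; rewrite limn_einf_lim; apply: lime_ge; first exact: is_cvg_einfs.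
exists N => // m /= Nm; apply: le_ereal_inf_tmp => _ [k /= mk <-].
by apply: xu => /=; exact: leq_trans mk.
Qed.

Lemma limn_einf_le u x : (forall k, u k <= x) -> limn_einf u <= x.
Proof.
move=> ux; rewrite limn_einf_lim; apply: lime_le; first exact: is_cvg_einfs.
apply: nearW => m; apply: le_trans (ux m).
by apply: ereal_inf_lbound; exists m => /=.
Qed.

Lemma measurable_fun_limn_einf d (T : measurableType d) (f : (T -> \bar R)^nat) :
  (forall k, measurable_fun setT (f k)) ->
  measurable_fun setT (fun t => limn_einf (f ^~ t)).
Proof.
move=> mf; rewrite /limn_einf.
suff /measurable_fun_limn_esup mN : forall k, measurable_fun setT (fun t => - f k t).
  exact: (measurableT_comp (@oppe_measurable R setT) mN).
by move=> k; exact: measurableT_comp.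
Qed.

(* The sum over the points of the process in the theorem is not known to be
   measurable a priori. *)
Lemma le_integral_nonmeasurable d (T : measurableType d) (P : {measure set T -> \bar R})
    (f g : T -> \bar R) :
  (forall t, 0 <= f t) -> (forall t, f t <= g t) ->
  \int[P]_t f t <= \int[P]_t g t.
Proof.
move=> f0 fg; rewrite !ge0_integralTE//; last by move=> t; exact: le_trans (fg t).
apply: ge_ereal_sup => _ [h hf <-]; apply: ereal_sup_ubound; exists h => // t.
exact: le_trans (hf t) (fg t).
Qed.

End einf_bounds.

(** * The squared increment for a fixed realization *)

Section adding_a_piece.
Context {R : realType} {n : nat}.
Implicit Types (U V Y Z : locfin R n).
Variables (S Rad : locfin R n -> R) (f : R -> R).
Hypothesis hRad : radius_of_influence S Rad f.

(** The ball enters the estimates only through this cube, whose volume is explicit. The absolute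
    value is there because a radius of influence may be negative. *)
Lemma dilated_ball_box (r : R) : dilated_ball r `<=` (box `|r| : set (n.-tuple R)).
Proof.
move=> _ [b /= b1 <-] i; rewrite tnth_mktuple -ler_norml normrM.
by rewrite ler_piMr// (le_trans (euclidean_norm_ge _ _)).
Qed.

Lemma radius_of_influence_bounded Z : `|S Z| <= `|S point| + f (Rad point).
Proof.
have [_] := hRad point Z point (@sub0set _ _).
rewrite locfin0U => h; rewrite -[in leLHS](subrK (S point) (S Z)).
by rewrite (le_trans (ler_normD _ _))// addrC lerD2l distrC.
Qed.

(** If V has at least two points in the cube, the f^2 term suffices; if V misses the ball, the left
    side is 0. Otherwise, from some level on, the only point x of V in the ball is alone in its
    cell, and that cell's summand equals the left side. *)
Lemma new_isolated_gain_ge Y V : V `&` Y = set0 ->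
  (((S (locfinU Y V) - S Y) ^+ 2)%:E <=
   limn_einf (fun k => (new_isolated_gain S k Y V)%:E) +
   (f (Rad Y) ^+ 2 * \1_(two_points (box `|Rad Y|)) V)%:E)%E.
Proof.
move=> VY0; set r := Rad Y.
have einf_ge0 : (0 <= limn_einf (fun k => (new_isolated_gain S k Y V)%:E))%E.
  by apply: limn_einf_ge; apply: nearW => k; rewrite lee_fin new_isolated_gain_ge0.
have [V2|V2] := pselect (two_points (box `|r|) V).
  rewrite indicE mem_set// mulr1; apply: (@le_trans _ _ (f r ^+ 2)%:E); last first.
    by rewrite leeDr.
  have [_ SYV] := hRad Y V point (@sub0set _ _).
  rewrite lee_fin -real_normK ?num_real// distrC ler_pXn2r// ?nnegrE//.
  exact: le_trans SYV.
rewrite indicE memNset// mulr0 adde0.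
have [V0|[x [Vx xr]]] : V `<=` ~` dilated_ball r \/
    exists x, Defs.support V x /\ dilated_ball r x.
  have [[x Vx]|nx] := pselect (exists x, Defs.support V x /\ dilated_ball r x).
    by right; exists x.
  by left=> x Vx xr; apply: nx; exists x.
  by have [<- _] := hRad Y point V V0; rewrite subrr expr0n.
have Vball y : Defs.support V y -> dilated_ball r y -> y = x.
  move=> Vy yr; apply: contrapT => yx; apply: V2; apply/counting_geP.
  exists [:: x; y]; first by rewrite /= inE andbT; split=> //; apply/eqP/nesym.
  move=> z /=; rewrite !inE => /orP[] /eqP ->; split=> //; exact: dilated_ball_box.
(* By disjointness, deleting x leaves Y intact, and what remains of V lies outside the ball. *)
have SY : S (locfinD1 (locfinU Y V) x) = S Y.
  have -> : locfinD1 (locfinU Y V) x = locfinU Y (locfinD1 V x).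
    apply: locfin_ext => /=; rewrite setDUl; congr (_ `|` _).
    apply/seteqP; split=> [y []//|y Yy]; split=> // /= yx.
    by have : set0 y by rewrite -VY0; split=> //; rewrite yx.
  have [|<-//] := hRad Y point (locfinD1 V x).
  by move=> y [Vy yx] yr; apply: yx; exact: Vball.
apply: limn_einf_ge; have := cells_isolate (locfinU Y V) x.
apply: filterS => k isol; rewrite lee_fin /new_isolated_gain.
rewrite (bigD1 (cell_of k x))//= -[leLHS]addr0.
have Ycell : avoiding (cell k (cell_of k x)) Y.
  apply/seteqP; split=> // y [Yy yx].
  by rewrite -VY0; have := isol y (or_introl Yy) yx => yxE; rewrite yxE in Yy *.
have Vcell : V `&` cell k (cell_of k x) = [set x].
  apply/seteqP; split=> [y [Vy yx]|_ ->//].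
  exact: (isol y (or_intror Vy) yx).
apply: lerD; last first.
  apply: sumr_ge0 => b _.
  by apply: mulr_ge0; [apply: mulr_ge0; rewrite indicE ler0n|exact: sqr_ge0].
rewrite !indicE !mem_set ?mul1r//; last exact: one_point_set1 Vcell.
rewrite /cell_gain (_ : locfinD _ _ = locfinD1 (locfinU Y V) x).
  by rewrite SY -sqrrN opprB.
apply: locfin_ext => /=; apply/seteqP; split=> y [Yy ny]; split=> //.
  by move=> yx; apply: ny; rewrite yx.
by move=> /(isol y Yy).
Qed.

End adding_a_piece.

Section main_bound.
Context {R : realType} {n : nat}.
Implicit Types (U V Y Z : locfin R n) (p q : probability (locfin R n) R).
Variables (S Rad : locfin R n -> R) (f : R -> R).
Hypothesis hRad : radius_of_influence S Rad f.
Hypothesis bS : bounded_measurable S.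

Lemma bm_increment :
  bounded_measurable (fun z => (S (locfinU z.1 z.2) - S z.1) ^+ 2).
Proof.
apply: bmX; apply: bmD; last apply: bmN.
  exact: (bm_comp bS measurable_locfinU).
exact: (bm_comp bS measurable_fst).
Qed.

Definition einf_gain U V := limn_einf (fun k => (new_isolated_gain S k U V)%:E).

Lemma einf_gain_ge0 U V : (0 <= einf_gain U V)%E.
Proof.
by apply: limn_einf_ge; apply: nearW => k; rewrite lee_fin new_isolated_gain_ge0.
Qed.

Lemma measurable_einf_gain : measurable_fun setT (fun z => einf_gain z.1 z.2).
Proof.
apply: measurable_fun_limn_einf => k; apply/measurable_EFinP.
by case: (bm_new_isolated_gain S bS k).
Qed.

(** Fatou's lemma: a bound uniform in the level survives, although the level that isolates a point
    depends on the realization. *)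
Lemma integral_einf_gain_le p q (a : \bar R) :
  (forall k, (\int[p]_u \int[q]_v new_isolated_gain S k u v)%:E <= a)%E ->
  (\int[p]_u \int[q]_v einf_gain u v <= a)%E.
Proof.
move=> gain_le; rewrite -(fubini_tonelli1 (m1 := p) (m2 := q) (fun z => einf_gain z.1 z.2)); last 2 first.
- exact: measurable_einf_gain.
- by move=> z; exact: einf_gain_ge0.
apply: (le_trans (fatou (p \x q)%E measurableT
  (f := fun k z => (new_isolated_gain S k z.1 z.2)%:E) _ _)).
- by move=> k; apply/measurable_EFinP; case: (bm_new_isolated_gain S bS k).
- by move=> k z _; rewrite lee_fin new_isolated_gain_ge0.
apply: limn_einf_le => k; apply: le_trans (gain_le k).
have bk := bm_new_isolated_gain S bS k.
rewrite (EFin_Rintegral _ (bm_int (fun u v => new_isolated_gain S k u v) bk q)).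
rewrite fubini_tonelli1; last 2 first.
- by apply/measurable_EFinP; case: bk.
- by move=> z; rewrite lee_fin new_isolated_gain_ge0.
rewrite le_eqVlt; apply/orP; left; apply/eqP; apply: eq_integral => u _.
by rewrite (EFin_Rintegral _ (bm_pair2 _ bk u)).
Qed.

(** Two points in the cube of volume (2|r|)^n have probability at most mu^2 (2|r|)^(2n). This is the
    origin of 4^n and of the exponent 2n in the moment hypothesis. *)
Lemma integral_increment_le (mu : R) q Y : (0 < n)%N ->
  0 <= mu -> poisson_law mu q -> rare_two_points mu q ->
  ((\int[q]_v (S (locfinU Y v) - S Y) ^+ 2)%:E <= \int[q]_v einf_gain Y v +
   ((mu ^+ 2 * 4 ^+ n) * (f (Rad Y) ^+ 2 * Rad Y ^+ (2 * n)))%:E)%E.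
Proof.
move=> n0 mu0 pq rq.
have mbox := measurable_cube (`|Rad Y|) (n := n).
have m2 := measurable_two_points _ mbox.
have bincr : bounded_measurable (fun v => (S (locfinU Y v) - S Y) ^+ 2).
  exact: (bm_pair2 (fun u v => (S (locfinU u v) - S u) ^+ 2) bm_increment Y).
have mG : measurable_fun setT (einf_gain Y).
  exact: (measurable_fun_pair2 Y measurable_einf_gain).
have mI : measurable_fun setT
    (fun v : locfin R n => (f (Rad Y) ^+ 2 * \1_(two_points (box `|Rad Y|)) v)%:E).
  apply/measurable_EFinP; apply: measurable_funM => //; exact: measurable_indic.
rewrite (EFin_Rintegral _ bincr).
apply: (@le_trans _ _ (\int[q]_v (einf_gain Y v +
   (f (Rad Y) ^+ 2 * \1_(two_points (box `|Rad Y|)) v)%:E))%E).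
  apply: ae_ge0_le_integral => //.
  - by move=> v _; rewrite lee_fin sqr_ge0.
  - by apply/measurable_EFinP; case: bincr.
  - move=> v _; rewrite adde_ge0 ?einf_gain_ge0// lee_fin.
    by apply: mulr_ge0; [exact: sqr_ge0|rewrite indicE ler0n].
  - exact: emeasurable_funD.
  apply: filterS (poisson_law_ae_disjoint mu q Y n0 pq) => v vY _.
  exact: new_isolated_gain_ge.
rewrite ge0_integralD//; last 2 first.
- by move=> v _; exact: einf_gain_ge0.
- by move=> v _; rewrite lee_fin; apply: mulr_ge0;
    [exact: sqr_ge0|rewrite indicE ler0n].
rewrite leeD2l//; under eq_integral do rewrite EFinM.
rewrite ge0_integralZl//; [|by apply/measurable_EFinP; exact: measurable_indic|by rewrite lee_fin sqr_ge0].
rewrite integral_indic// setIT.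
have r2 := rq _ mbox; rewrite lebesgue_tuple_cube// in r2.
apply: (@le_trans _ _ ((f (Rad Y) ^+ 2)%:E *
    ((mu * fine ((2 * `|Rad Y|) ^+ n)%:E) ^+ 2)%:E)%E).
  by apply: lee_wpmul2l; [rewrite lee_fin sqr_ge0|apply: r2; rewrite ltry].
rewrite -EFinM lee_fin /= le_eqVlt; apply/orP; left; apply/eqP.
rewrite [Rad Y ^+ (2 * n)]exprM -[Rad Y ^+ 2]real_normK ?num_real//.
rewrite -!exprM !exprMn -!exprM [(n * 2)%N]mulnC exprM.
have -> : 2 ^+ 2 = 4 :> R by ring.
by set a := 4 ^+ n; set b := `|Rad Y| ^+ (2 * n); ring.
Qed.

End main_bound.

(** * Conclusion *)

Section main_inequality.
Context {R : realType} {n : nat} {d : measure_display} {T : measurableType d}.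
Variables (P : probability T R) (S : locfin R n -> R).
Hypothesis bS : bounded_measurable S.

Lemma Rint_distribution (X : {RV P >-> locfin R n}) (g : locfin R n -> R) :
  bounded_measurable g -> \int[distribution P X]_z g z = \int[P]_w g (X w).
Proof.
move=> bg; have mX : measurable_fun setT X by exact: measurable_funP.
have bgX : bounded_measurable (fun w => g (X w)) by exact: bm_comp bg mX.
rewrite /Rintegral integral_distribution//; last exact: bm_integrable bgX.
by apply/measurable_EFinP; case: bg.
Qed.

Lemma variance_distribution (X : {RV P >-> locfin R n}) :
  'V_P[fun w => S (X w)] = (var (distribution P X) S)%:E.
Proof.
have mX : measurable_fun setT X by exact: measurable_funP.
have bSX : bounded_measurable (fun w => S (X w)) by exact: bm_comp bS mX.
have bvar : bounded_measurable
    (fun z => (S z - \int[distribution P X]_y S y) ^+ 2).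
  by apply: bmX; apply: bmD => //; exact: bm_cst.
rewrite /var Rint_distribution// EFin_Rintegral; last exact: bm_comp bvar mX.
rewrite /variance unlock unlock.
by apply: eq_integral => w _; rewrite /= Rint_distribution// -expr2.
Qed.

End main_inequality.

Section isolated_gain_superposition.
Context {R : realType} {n : nat}.
Variables (S : locfin R n -> R) (p : nat -> probability (locfin R n) R).
Hypothesis bS : bounded_measurable S.
Hypothesis p0 : forall g : locfin R n -> R, bounded_measurable g ->
  \int[p 0]_x g x = g point.
Hypothesis pS : forall j (g : locfin R n -> R), bounded_measurable g ->
  \int[p j.+1]_x g x = \int[p j]_u \int[p 1]_v g (locfinU u v).

(** Exchangeability is applied in each cell separately: avoidance indicators multiply under union,
    and one-point indicators satisfy the superadditivity that [marked_part] asks for. *)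
Lemma new_isolated_gain_le j k :
  j.+1%:R * \int[p j]_u \int[p 1]_v new_isolated_gain S k u v <=
  \int[p j.+1]_z isolated_gain S k z.
Proof.
have bnew b := bm_new_cell_gain S bS (cell k b) (measurable_cell k b).
have biso b : bounded_measurable
    (fun z => \1_(one_point (cell k b)) z * cell_gain S (cell k b) z).
  have mb := measurable_cell k b; apply: bmM; last exact: bm_cell_gain.
  by apply: bm_indic; exact: measurable_one_point.
have -> : \int[p j]_u \int[p 1]_v new_isolated_gain S k u v =
    \sum_(b : {ffun 'I_k -> bool}) \int[p j]_u \int[p 1]_v
      (\1_(avoiding (cell k b)) u * \1_(one_point (cell k b)) v *
       cell_gain S (cell k b) (locfinU u v)).
  rewrite -bm_Rint_sum => [|b]; last exact: (bm_int _ (bnew b)).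
  apply: eq_Rint => u; rewrite -bm_Rint_sum// => b.
  exact: (bm_pair2 (fun u v => \1_(avoiding (cell k b)) u *
    \1_(one_point (cell k b)) v * cell_gain S (cell k b) (locfinU u v)) (bnew b) u).
rewrite /isolated_gain bm_Rint_sum// mulr_sumr; apply: ler_sum => b _.
have mb : measurable (cell k b : set (n.-tuple R)) := measurable_cell k b.
apply: (marked_part (@locfinU R n) point p locfinUA locfinUC locfin0U
  measurable_locfinU p0 pS j _ _ (cell_gain S (cell k b))).
- exact: (bm_indic (measurable_avoiding _ mb)).
- exact: (bm_indic (measurable_one_point _ mb)).
- exact: (bm_cell_gain S bS _ mb).
- by move=> u; rewrite indicE ler0n lern1 leq_b1.
- by move=> u; rewrite indicE ler0n.
- by move=> u; exact: sqr_ge0.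
- exact: avoiding_locfinU.
- exact: one_point_locfinU.
Qed.

End isolated_gain_superposition.

Lemma limn_einf_ge_error (R : realType) (u : (\bar R)^nat) (v : \bar R) (C : R) :
  (forall m, v <= u m.+1 + (C / m.+1%:R)%:E)%E -> (v <= limn_einf u)%E.
Proof.
move=> v_le; apply/lee_addgt0Pr => e e0.
rewrite addeC -limn_einf_shift//; apply: limn_einf_ge.
exists (Num.truncn (`|C| / e)).+1 => // -[//|m] /= Nm.
apply: le_trans (v_le m) _; rewrite addeC leeD2r// lee_fin.
rewrite ler_pdivrMr ?ltr0n// (le_trans (ler_norm C))// mulrC -ler_pdivrMr//.
by apply/ltW/(lt_le_trans (truncnS_gt _)); rewrite ler_nat.
Qed.

(** Convergence of the expectations is not asserted: each m gives a bound with error C/(m+1), which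
    yields the lower limit unconditionally and the limit whenever it exists. *)
Theorem theorem4 (R : realType) (n : nat) (n_gt0 : (0 < n)%N)
  (disp : measure_display) (T : measurableType disp) (P : probability T R)
  (lambda : R) (lambda_gt0 : 0 < lambda)
  (X : {RV P >-> locfin R n}) (Xp : nat -> {RV P >-> locfin R n})
  (hX : stationary_poisson_process lambda X)
  (hXp : forall m : nat, (0 < m)%N ->
     stationary_poisson_process (lambda * (1 + m%:R^-1)) (Xp m))
  (S : locfin R n -> R) (mS : measurable_fun [set: locfin R n] S)
  (Rad : locfin R n -> R) (f : R -> R)
  (hRad : radius_of_influence S Rad f)
  (mRad : measurable_fun [set: T] (fun w => Rad (X w)))
  (hint : P.-integrable [set: T]
     (fun w => (f (Rad (X w)) ^+ 2 * Rad (X w) ^+ (2 * n))%:E)) :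
  let u (m : nat) : \bar R := (\int[P]_w
     \esum_(x in Xp m w) ((S (locfinD1 (Xp m w) x) - S (Xp m w)) ^+ 2)%:E)%E in
  ('V_P[fun w => S (X w)] <= limn_einf u)%E /\
  (cvgn u -> ('V_P[fun w => S (X w)] <= limn u)%E).
Proof.
move=> u.
pose K := (\int[P]_w (f (Rad (X w)) ^+ 2 * Rad (X w) ^+ (2 * n))%:E)%E.
have K_fin : K \is a fin_num by exact: integrable_fin_num hint.
have fR_ge0 w : 0 <= f (Rad (X w)) ^+ 2 * Rad (X w) ^+ (2 * n).
  by apply: mulr_ge0; [exact: sqr_ge0|rewrite exprM exprn_ge0// sqr_ge0].
have K_ge0 : (0 <= K)%E by apply: integral_ge0 => w _; rewrite lee_fin.
have bS : bounded_measurable S.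
  split=> //; exists (`|S point| + f (Rad point)).
  exact: radius_of_influence_bounded hRad.
(* The error is (m+2) mu^2 4^n K with mu = lambda/(m+1); the factor 2 bounds (m+2)/(m+1). *)
pose C := 2 * lambda ^+ 2 * 4 ^+ n * fine K.
have var_le m : ('V_P[fun w => S (X w)] <= u m.+1 + (C / m.+1%:R)%:E)%E.
  (* X consists of m+1 pieces of intensity [mu] and X^+ of m+2, which is the index m+1 of [u]; index
     0 is skipped, as [hXp] excludes it. *)
  pose mu := lambda / m.+1%:R.
  have mu0 : 0 <= mu by rewrite divr_ge0// ltW.
  have rate_ge0 j : 0 <= j%:R * mu by rewrite mulr_ge0.
  have /choice[p pP] : forall j : nat, exists q : probability (locfin R n) R,
      poisson_law (j%:R * mu) q /\ rare_two_points (j%:R * mu) q.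
    by move=> j; exact: (exists_poisson_law _ n_gt0 lambda_gt0 (rate_ge0 j) hX).
  have p0 (g : locfin R n -> R) : bounded_measurable g ->
      \int[p 0%N]_x g x = g point.
    move=> bg; rewrite -[RHS](Rint_dirac point g bg).
    apply: (poisson_law_Rint (pP 0%N).1); rewrite mul0r; exact: poisson_law0.
  have pS j (g : locfin R n -> R) : bounded_measurable g ->
      \int[p j.+1]_x g x = \int[p j]_a \int[p 1%N]_b g (locfinU a b).
    apply: (poisson_law_superposition (pP j).1 (pP 1%N).1).
    by rewrite -mulrDl natr1; exact: (pP j.+1).1.
  have lawX : poisson_law (m.+1%:R * mu) (distribution P X).
    rewrite /mu mulrC divfK ?pnatr_eq0//.
    exact: (distribution_poisson_law lambda_gt0 hX).
  have lawXp : poisson_law (m.+2%:R * mu) (distribution P (Xp m.+1)).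
    have rateE : lambda * (1 + m.+1%:R^-1) = m.+2%:R * mu.
      rewrite /mu -[m.+2%:R]natr1 mulrDr mulr1 mulrDl mul1r mulrCA.
      by rewrite divff ?pnatr_eq0// mulr1.
    rewrite -rateE; apply: distribution_poisson_law; last exact: hXp.
    by rewrite rateE mulr_gt0// divr_gt0.
  have [q1 r1] := pP 1%N; rewrite mul1r in q1 r1.
  pose A := \int[distribution P X]_a \int[p 1%N]_b (S (locfinU a b) - S a) ^+ 2.
  have u_ge0 : (0 <= u m.+1)%E.
    apply: integral_ge0 => w _; apply: esum_ge0 => x _.
    by rewrite lee_fin sqr_ge0.
  have varA : var (distribution P X) S <= m.+2%:R * A.
    rewrite /A /var !(poisson_law_Rint lawX (pP m.+1).1).
    apply: le_trans (jackknife (@locfinU R n) point p locfinUA locfinUC locfin0U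
      measurable_locfinU p0 pS m S bS).
    exact: (efron_stein (@locfinU R n) point p locfinUA locfinUC locfin0U
      measurable_locfinU p0 pS m S bS).
  have gain_le k : ((\int[distribution P X]_a \int[p 1%N]_b
      new_isolated_gain S k a b)%:E <= (m.+2%:R^-1)%:E * u m.+1)%E.
    rewrite (poisson_law_Rint lawX (pP m.+1).1) lee_pdivlMl ?ltr0n//.
    rewrite -EFinM; apply: (@le_trans _ _ (\int[p m.+2]_z isolated_gain S k z)%:E).
      by rewrite lee_fin; exact: (new_isolated_gain_le S p bS p0 pS).
    have bk := bm_isolated_gain S bS k.
    have mXp : measurable_fun setT (Xp m.+1) by exact: measurable_funP.
    rewrite -(poisson_law_Rint lawXp (pP m.+2).1) Rint_distribution//.
    rewrite (EFin_Rintegral P (bm_comp bk mXp)).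
    apply: le_integral_nonmeasurable => w; first by rewrite lee_fin isolated_gain_ge0.
    exact: isolated_gain_le_esum.
  have c_ge0 : 0 <= mu ^+ 2 * 4 ^+ n by rewrite mulr_ge0 ?sqr_ge0// exprn_ge0.
  have AE : (A%:E <= (m.+2%:R^-1)%:E * u m.+1 + (mu ^+ 2 * 4 ^+ n)%:E * K)%E.
    have bincr := bm_increment S bS.
    have mX : measurable_fun setT X by exact: measurable_funP.
    pose G z := (\int[p 1%N]_b einf_gain S z b)%E.
    have mG : measurable_fun setT G.
      apply: (measurable_fun_fubini_tonelli_F (m2 := p 1%N)
        (fun z => einf_gain S z.1 z.2)); first exact: measurable_einf_gain.
      by move=> z; exact: einf_gain_ge0.
    have G_ge0 z : (0 <= G z)%E by apply: integral_ge0 => b _; exact: einf_gain_ge0.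
    pose I z := \int[p 1%N]_b (S (locfinU z b) - S z) ^+ 2.
    have bI : bounded_measurable I.
      exact: (bm_int (fun z b => (S (locfinU z b) - S z) ^+ 2) bincr).
    have I_ge0 z : 0 <= I z by apply: Rint_ge0 => b; exact: sqr_ge0.
    have mrad : measurable_fun setT
        (fun w => (f (Rad (X w)) ^+ 2 * Rad (X w) ^+ (2 * n))%:E).
      exact: measurable_int hint.
    have bIX := bm_comp bI mX.
    (* The comparison takes place on [T] and not under the law of X: the moment integrand is known
       to be measurable only after composition with X. *)
    rewrite /A (Rint_distribution P X I bI) (EFin_Rintegral P bIX).
    apply: (@le_trans _ _ (\int[P]_w (G (X w) + (mu ^+ 2 * 4 ^+ n)%:E *
        (f (Rad (X w)) ^+ 2 * Rad (X w) ^+ (2 * n))%:E))%E).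
      apply: ge0_le_integral => //.
      - by move=> w _; rewrite lee_fin.
      - by apply/measurable_EFinP; case: bIX.
      - by apply: emeasurable_funD; [exact: measurableT_comp|exact: measurable_funeM].
      - move=> w _; rewrite -EFinM.
        exact: (integral_increment_le S Rad f hRad bS).
    rewrite ge0_integralD//; last 3 first.
    - exact: measurableT_comp.
    - by move=> w _; rewrite mule_ge0// lee_fin.
    - exact: measurable_funeM.
    rewrite ge0_integralZl//; last by move=> w _; rewrite lee_fin.
    rewrite leeD2r//.
    rewrite -(ge0_integral_distribution X mG G_ge0).
    exact: (integral_einf_gain_le S bS).
  rewrite (variance_distribution P S bS X).
  apply: (@le_trans _ _ (m.+2%:R * A)%:E); first by rewrite lee_fin.
  rewrite EFinM; apply: (@le_trans _ _ (m.+2%:R%:E *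
    ((m.+2%:R^-1)%:E * u m.+1 + (mu ^+ 2 * 4 ^+ n)%:E * K))%E).
    by apply: lee_wpmul2l => //; rewrite lee_fin.
  rewrite -(fineK K_fin) -EFinM ge0_muleDr//; last 2 first.
  - by rewrite mule_ge0// lee_fin invr_ge0.
  - by rewrite lee_fin; apply: mulr_ge0 => //; exact: fine_ge0.
  rewrite muleA -EFinM divff ?pnatr_eq0// mul1e leeD2l// -EFinM lee_fin.
  have -> : m.+2%:R * (mu ^+ 2 * 4 ^+ n * fine K) =
      m.+2%:R / m.+1%:R * (lambda ^+ 2 * 4 ^+ n * fine K) / m.+1%:R.
    have : m.+1%:R != 0 :> R by rewrite pnatr_eq0.
    rewrite /mu; move: m.+1%:R m.+2%:R (4 ^+ n) => M N x M0; field; exact: M0.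
  have -> : C / m.+1%:R = 2 * (lambda ^+ 2 * 4 ^+ n * fine K) / m.+1%:R.
    by rewrite /C !mulrA.
  rewrite ler_wpM2r ?invr_ge0// ler_wpM2r//.
    apply: mulr_ge0; last exact: fine_ge0.
    by rewrite mulr_ge0 ?sqr_ge0// exprn_ge0.
  by rewrite ler_pdivrMr ?ltr0n// -natrM ler_nat mul2n -addnn addnS ltnS leq_addr.
split; first exact: (limn_einf_ge_error R u _ C var_le).
by move=> /is_cvg_limn_einfE <-; exact: (limn_einf_ge_error R u _ C var_le).
Qed.
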